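(* Let $\mathbf J$ and $\widehat{\mathbf J}$ be the minimal block Jacobi operators in $l^2(\mathbb N_0;\mathbb C^p)$ with entries $\mathcal A_n=\mathcal A_n^*$, $\mathcal B_n$ and $\widehat{\mathcal A}_n=\widehat{\mathcal A}_n^*$, $\widehat{\mathcal B}_n$ in $\mathbb C^{p\times p}$, respectively, where all $\mathcal B_n$ and $\widehat{\mathcal B}_n$ are invertible, $n\in\mathbb N_0$. Let for some $N\in\mathbb N_0$ the following conditions hold: (i) $\displaystyle\sup_{n\ge N}\|\mathbb I_p-\widehat{\mathcal B}_n^*(\mathcal B_n^* )^{-1}\|=a_N<1$; (ii) $\displaystyle\sup_{n\ge N,\ n\ge1}\|\widehat{\mathcal B}_n-\widehat{\mathcal B}_{n-1}^*(\mathcal B_{n-1}^* )^{-1}\mathcal B_n\|=C_B<\infty$; (iii) for each $\varepsilon>0$ there exist $N_1=N_1(\varepsilon)\in\mathbb N$ and $C_A'(\varepsilon)>0$ such that for each finitely supported sequence $f\in l_0^2(\mathbb N_0;\mathbb C^p)$ $$\sum_{n\ge N_1}\big\|\big(\widehat{\mathcal A}_n-\widehat{\mathcal B}_{n-1}^*(\mathcal B_{n-1}^* )^{-1}\mathcal A_n\big)f_n\big\|_{\mathbb C^p}^2\le\varepsilon\|\mathbf Jf\|_{l^2}^2+C_A'(\varepsilon)\|f\|_{l^2}^2 .$$ Then: (a) $\mathrm{dom}\,\mathbf J=\mathrm{dom}\,\widehat{\mathbf J}$ and $n_\pm(\mathbf J)=n_\pm(\widehat{\mathbf J})$; (b) moreover,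 if $\mathbf J=\mathbf J^*$ and the spectrum of $\mathbf J$ is discrete, then $\widehat{\mathbf J}=\widehat{\mathbf J}^*$ and the spectrum of $\widehat{\mathbf J}$ is discrete too.
   Context: Let $p\in\mathbb N$ and $\mathbb N_0=\mathbb N\cup\{0\}$; $\mathbb I_p$ is the $p\times p$ identity matrix. The block Jacobi matrix with entries $\mathcal A_n,\mathcal B_n$ acts by $(\mathbf Jf)_n=\mathcal B_{n-1}^*f_{n-1}+\mathcal A_nf_n+\mathcal B_nf_{n+1}$ (with the term containing $f_{-1}$ omitted for $n=0$). The minimal operator is the closure in $l^2(\mathbb N_0;\mathbb C^p)$ of this map restricted to the set $l^2_0(\mathbb N_0;\mathbb C^p)$ of finitely supported sequences; similarly for $\widehat{\mathbf J}$. Deficiency indices: $n_\pm(\mathbf J)=\dim\ker(\mathbf J^*\mp iI)$. A selfadjoint operator has discrete spectrum if its resolvent is compact. Norms of matrices are operator norms. *)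

(* Defs.v *)
From HB Require Import structures.
From mathcomp Require Import all_boot all_order all_algebra.
From mathcomp Require Import complex.
From mathcomp Require Import all_classical all_reals all_analysis.

Set Implicit Arguments.
Unset Strict Implicit.
Unset Printing Implicit Defensive.
Import Order.TTheory GRing.Theory Num.Theory numFieldNormedType.Exports.

Local Open Scope classical_set_scope.
Local Open Scope ring_scope.
Local Open Scope complex_scope.
Local Open Scope sesquilinear_scope.

Section FiniteDimensional.
Context {R : realType} {p : nat}.

Definition vdot (u v : 'cV[R[i]]_p) : R[i] := (v ^t* *m u) 0 0.

Definition vnorm (v : 'cV[R[i]]_p) : R := Num.sqrt (complex.Re (vdot v v)).

Definition opnorm (M : 'M[R[i]]_p) : R :=
  sup [set vnorm (M *m v) | v in [set v | vnorm v <= 1]].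

End FiniteDimensional.

Notation vecseq R p := (nat -> 'cV[R[i]]_p).

Section SequenceSpace.
Context {R : realType} {p : nat}.

Implicit Types f g : vecseq R p.

Definition l2normsq f : \bar R := (\sum_(0 <= n <oo) (vnorm (f n) ^+ 2)%:E)%E.

Definition l2 : set (vecseq R p) := [set f | (l2normsq f < +oo)%E].

(* Linear in the first argument; meaningful for f and g in l2, where both
   series converge absolutely. *)
Definition l2dot f g : R[i] :=
  limn (series (fun n => complex.Re (vdot (f n) (g n)))) +i*
  limn (series (fun n => complex.Im (vdot (f n) (g n)))).

Definition l2cvg (u : nat -> vecseq R p) f : Prop :=
  l2normsq (u k - f) @[k --> \oo] --> 0%E.

Definition finsupp f : Prop := exists m, forall n, (m <= n)%N -> f n = 0.

Definition lin_indep (k : nat) (v : 'I_k -> vecseq R p) : Prop :=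
  forall c : 'I_k -> R[i], \sum_i c i *: v i = 0 -> forall i, c i = 0.

(* The dimension of a linear subspace V, as an element of N u {+oo}: the
   supremum of the sizes of linearly independent finite families in V. *)
Definition subspace_dim (V : set (vecseq R p)) : \bar R :=
  ereal_sup [set (k%:R)%:E | k in
    [set k | exists v : 'I_k -> vecseq R p, (forall i, V (v i)) /\ lin_indep v]].

End SequenceSpace.

(* An operator in l2 is identified with its graph, the set of pairs (f, T f)
   with f in dom T; equality of operators (including equality of their
   domains) is then equality of sets. *)
Section Operators.
Context {R : realType} {p : nat}.
Local Notation E := (vecseq R p).
Implicit Types (T K : set (E * E)) (z : R[i]).

Definition op_dom T : set E := [set f | exists g, T (f, g)].

Definition op_ker T : set E := [set f | T (f, 0)].

Definition op_inv T : set (E * E) := [set fg | T (fg.2, fg.1)].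

(* T - z I *)
Definition op_shift T z : set (E * E) := [set fg | T (fg.1, fg.2 + z *: fg.1)].

Definition op_closure T : set (E * E) :=
  [set fg | l2 fg.1 /\ l2 fg.2 /\
     exists u v : nat -> E,
       (forall k, T (u k, v k)) /\ l2cvg u fg.1 /\ l2cvg v fg.2].

Definition op_adj T : set (E * E) :=
  [set gh | l2 gh.1 /\ l2 gh.2 /\
     forall f f', T (f, f') -> l2dot f' gh.1 = l2dot f gh.2].

Definition selfadjoint T : Prop := T = op_adj T.

Definition deficiency_plus T : \bar R :=
  subspace_dim (op_ker (op_shift (op_adj T) 'i)).

Definition deficiency_minus T : \bar R :=
  subspace_dim (op_ker (op_shift (op_adj T) (- 'i))).

Definition bounded_on_l2 K : Prop :=
  (forall g f, K (g, f) -> l2 g /\ l2 f) /\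
  (forall g, l2 g -> exists! f, K (g, f)) /\
  exists M : R, forall g f, K (g, f) -> (l2normsq f <= M%:E * l2normsq g)%E.

Definition compact_on_l2 K : Prop :=
  bounded_on_l2 K /\
  forall u v : nat -> E,
    (forall k, K (u k, v k)) ->
    (exists M : R, forall k, (l2normsq (u k) <= M%:E)%E) ->
    exists s : nat -> nat, exists f : E,
      (forall k, (s k < s k.+1)%N) /\ l2 f /\ l2cvg (v \o s) f.

Definition resolvent T z : set (E * E) := op_inv (op_shift T z).

Definition resolvent_set T : set R[i] := [set z | bounded_on_l2 (resolvent T z)].

(* Compact resolvent. By the resolvent identity, compactness at one point of
   the resolvent set is equivalent to compactness at all of them. *)
Definition discrete_spectrum T : Prop :=
  exists z, resolvent_set T z /\ compact_on_l2 (resolvent T z).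

End Operators.

Section Jacobi.
Context {R : realType} {p : nat}.
Variables A B : nat -> 'M[R[i]]_p.

Definition jacobi_map (f : vecseq R p) : vecseq R p := fun n =>
  (if n is m.+1 then (B m) ^t* *m f m else 0) + A n *m f n + B n *m f n.+1.

Definition jacobi_op : set (vecseq R p * vecseq R p) :=
  op_closure [set fg | finsupp fg.1 /\ fg.2 = jacobi_map fg.1].

End Jacobi.

(* Main.v *)
Require Import Defs.
From HB Require Import structures.
From mathcomp Require Import all_boot all_order all_algebra.
From mathcomp Require Import complex.
From mathcomp Require Import all_classical all_reals all_analysis.
From mathcomp Require Import ring lra.

Import Order.TTheory GRing.Theory Num.Theory numFieldNormedType.Exports.
Local Open Scope classical_set_scope.
Local Open Scope ring_scope.
Local Open Scope complex_scope.
Local Open Scope sesquilinear_scope.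

Set Implicit Arguments.
Unset Strict Implicit.
Unset Printing Implicit Defensive.

(** Let J and hJ be the formal Jacobi maps and T_n = hB_n^* (B_n^* )^-1.  As
    T_(n-1) B_(n-1)^* = hB_(n-1)^*, row n of hJ f - T_(n-1) J f does not see
    f_(n-1): it is (hA_n - T_(n-1) A_n) f_n + (hB_n - T_(n-1) B_n) f_(n+1).
    The three hypotheses bound, for large n, the factor I - T_(n-1), the last
    coefficient and the middle one; the remaining rows are finitely many and
    depend on finitely many coordinates of f.  Hence
      |hJ f - J f| <= a |J f| + C |f|   with a < 1
    for finitely supported f ([relative_bound]).

    The rest is the stability theory of symmetric operators S0, S1 with a
    common domain D that satisfy such a bound.  Their graph norms are
    equivalent, so their closures have the same domain
    ([graph_closure_dom]).  For the deficiency indices, join them by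
    S_t = S0 + t (S1 - S0).  Each S_t is symmetric, so
    |S_t x +- i x|^2 = |S_t x|^2 + |x|^2, and the bound yields
    |S1 x - S0 x| <= M |S_t x +- i x| with M independent of t in [0, 1]
    ([path_rel]).  A step of length less than 1/M along the path therefore
    perturbs S_t +- i by an operator of relative norm less than 1.  Such a
    perturbation preserves the dimension of the orthogonal complement of the
    range ([perp_ran_transfer]): the orthogonal projection of one complement
    to the other is injective, because a vector that it kills lies in the
    closure of one range and is orthogonal to the other, and a relative norm
    less than 1 leaves only 0 there.  Finitely many steps lead from S0 to S1
    ([defect_transfer]).

    If J is selfadjoint, both complements vanish for J, hence for hJ, which
    makes hJ selfadjoint ([perp_selfadjoint]) and i a point of its resolvent
    set.  For bounded u_k, the vectors v_k = (hJ - i)^-1 u_k are bounded in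
    the graph norm of hJ, hence in that of J; so v_k = (J - z)^-1 w_k with
    w_k bounded, and compactness of the resolvent of J at z provides the
    convergent subsequence ([compact_resolvent_transfer]).

    Inner products enter through their real parts only: on objects that are
    stable under multiplication by i, a complex identity between inner
    products is equivalent to the identity of the real parts. *)

(** * The discriminant inequality *)

Section Discriminant.
Context {R : realType}.

(** The Cauchy-Schwarz argument on numbers; the inner products of column
    vectors and of Hilbert spaces are both instances. *)
Lemma discriminant_le (a b c : R) :
  (forall t, 0 <= a + 2 * t * b + t ^+ 2 * c) -> 0 <= c -> b ^+ 2 <= a * c.
Proof.
move=> H c0; have [c1|c1] := eqVneq c 0; last first.
  have := H (- b / c); have c2 : 0 < c by rewrite lt_neqAle eq_sym c1.
  have -> : a + 2 * (- b / c) * b + (- b / c) ^+ 2 * c = (a * c - b ^+ 2) / c.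
    by field.
  by rewrite pmulr_lge0 ?invr_gt0// subr_ge0.
subst c; rewrite mulr0; have [->|b0] := eqVneq b 0; first by rewrite expr0n.
(* If c = 0 but b <> 0, the affine function takes the value -1. *)
have := H (- (a + 1) / (2 * b)).
have -> : a + 2 * (- (a + 1) / (2 * b)) * b + (- (a + 1) / (2 * b)) ^+ 2 * 0 = -1.
  by field.
by rewrite lerNr oppr0 ler10.
Qed.

Lemma cauchy_schwarz (a b c : R) :
  (forall t, 0 <= a + 2 * t * b + t ^+ 2 * c) -> 0 <= a -> 0 <= c ->
  `|b| <= Num.sqrt a * Num.sqrt c.
Proof.
move=> H a0 c0; rewrite -sqrtrM// -sqrtr_sqr ler_wsqrtr//.
exact: discriminant_le.
Qed.

End Discriminant.

(** * Hilbert spaces *)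

Section HilbertSpace.
Context {R : realType}.

Definition nrm {V : lmodType R[i]} (dot : V -> V -> R) x := Num.sqrt (dot x x).

(** The Hilbert space is a subset of an ambient vector space, because the
    Jacobi maps are defined on all sequences and do not preserve l2.  [dot] is
    the real part of the inner product; [dot_i2] makes it determine the
    complex one, as dot x y + i dot (-i x) y. *)
Record hilbert (V : lmodType R[i]) (H : set V) (dot : V -> V -> R) : Prop := {
  hil0 : H 0;
  hilD : forall x y, H x -> H y -> H (x + y);
  hilZ : forall c x, H x -> H (c *: x);
  dotC : forall x y, dot x y = dot y x;
  dotDl : forall x y z, H x -> H y -> H z -> dot (x + y) z = dot x z + dot y z;
  dotZl : forall t x y, H x -> H y -> dot (t%:C *: x) y = t * dot x y;
  dot_i2 : forall x y, dot ('i *: x) ('i *: y) = dot x y;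
  dot_ge0 : forall x, H x -> 0 <= dot x x;
  dot_eq0 : forall x, H x -> dot x x = 0 -> x = 0;
  hil_complete : forall u : nat -> V, (forall k, H (u k)) ->
    (forall e : R, 0 < e -> exists k0, forall m k, (k0 <= m)%N -> (k0 <= k)%N ->
      nrm dot (u m - u k) <= e) ->
    exists2 x, H x & forall e : R, 0 < e ->
      exists k0, forall k, (k0 <= k)%N -> nrm dot (u k - x) <= e }.

Context {V : lmodType R[i]} {H : set V} {dot : V -> V -> R}.
Hypothesis hilb : hilbert H dot.
Implicit Types (x y z : V) (t : R) (c : R[i]).
Let H0 := hil0 hilb.
Let HD := hilD hilb.
Let HZ := hilZ hilb.
Local Notation "'N'" := (nrm dot).

Lemma hilN x : H x -> H (- x).
Proof. by move=> hx; rewrite -scaleN1r; apply: HZ. Qed.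

Lemma hilB x y : H x -> H y -> H (x - y).
Proof. by move=> hx hy; apply: HD => //; apply: hilN. Qed.

Lemma dotDr x y z : H x -> H y -> H z -> dot z (x + y) = dot z x + dot z y.
Proof. by move=> *; rewrite (dotC hilb) (dotDl hilb)// ![dot _ z](dotC hilb). Qed.

Lemma dotZr t x y : H x -> H y -> dot y (t%:C *: x) = t * dot y x.
Proof. by move=> *; rewrite (dotC hilb) (dotZl hilb)// (dotC hilb). Qed.

Lemma dotNl x y : H x -> H y -> dot (- x) y = - dot x y.
Proof.
by move=> hf hg; rewrite -scaleN1r -(rmorphN1 (real_complex R)) (dotZl hilb)// mulN1r.
Qed.

Lemma dotNr x y : H x -> H y -> dot x (- y) = - dot x y.
Proof. by move=> *; rewrite (dotC hilb) dotNl// (dotC hilb). Qed.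

Lemma dotBl x y z : H x -> H y -> H z -> dot (x - y) z = dot x z - dot y z.
Proof. by move=> *; rewrite (dotDl hilb) ?dotNl//; apply: hilN. Qed.

Lemma dotBr x y z : H x -> H y -> H z -> dot z (x - y) = dot z x - dot z y.
Proof. by move=> *; rewrite dotDr ?dotNr//; apply: hilN. Qed.

Lemma dot0l x : H x -> dot 0 x = 0.
Proof. by move=> hx; rewrite -(subrr x) dotBl// subrr. Qed.

Lemma dot_iN x y : H x -> H y -> dot ('i *: x) y = - dot x ('i *: y).
Proof.
move=> hx hy; have hiy := HZ 'i hy.
rewrite -(dot_i2 hilb x) scalerA -expr2 sqr_i scaleN1r dotNr ?opprK//.
exact: HZ.
Qed.

Lemma nrm_ge0 x : 0 <= N x. Proof. exact: sqrtr_ge0. Qed.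

Lemma nrm_sqr x : H x -> N x ^+ 2 = dot x x.
Proof. by move=> hx; rewrite sqr_sqrtr// (dot_ge0 hilb). Qed.

Lemma nrm_eq0 x : H x -> N x = 0 -> x = 0.
Proof.
by move=> hx x0; apply: (dot_eq0 hilb hx); rewrite -nrm_sqr// x0 expr0n.
Qed.

Lemma dot_quadratic x y t : H x -> H y ->
  0 <= dot x x + 2 * t * dot x y + t ^+ 2 * dot y y.
Proof.
move=> hx hy; have hty := HZ t%:C hy; have hs := HD hx hty.
have := dot_ge0 hilb hs.
rewrite (dotDl hilb)// !dotDr// !(dotZl hilb)// !dotZr// [dot y x](dotC hilb).
move: (dot x x) (dot x y) (dot y y) => a b c.
suff -> : a + 2 * t * b + t ^+ 2 * c = a + t * b + (t * b + t * (t * c)) by [].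
by ring.
Qed.

Lemma dot_le x y : H x -> H y -> `|dot x y| <= N x * N y.
Proof.
move=> hx hy; apply: cauchy_schwarz; [|exact: (dot_ge0 hilb)..].
by move=> t; exact: dot_quadratic.
Qed.

Lemma nrmD x y : H x -> H y -> N (x + y) <= N x + N y.
Proof.
move=> hx hy; have := le_trans (ler_norm _) (dot_le hx hy).
move=> h; have hs := HD hx hy.
rewrite -ler_sqr ?nnegrE ?addr_ge0 ?nrm_ge0//.
rewrite sqrrD !nrm_sqr// (dotDl hilb)// !dotDr// [dot y x](dotC hilb).
lra.
Qed.

Lemma nrmRZ t x : H x -> N (t%:C *: x) = `|t| * N x.
Proof.
move=> hx; have htx := HZ t%:C hx.
rewrite /nrm (dotZl hilb)// dotZr// mulrA -expr2 sqrtrM ?sqr_ge0//.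
by rewrite sqrtr_sqr.
Qed.

Lemma nrm_i x : N ('i *: x) = N x.
Proof. by rewrite /nrm (dot_i2 hilb). Qed.

Lemma nrmN x : H x -> N (- x) = N x.
Proof.
move=> hx; rewrite -scaleN1r -(rmorphN1 (real_complex R)) nrmRZ//.
by rewrite normrN1 mul1r.
Qed.

Lemma nrmBC x y : H x -> H y -> N (x - y) = N (y - x).
Proof. by move=> hx hy; rewrite -opprB nrmN//; apply: hilB. Qed.

Lemma nrmB x y : H x -> H y -> N (x - y) <= N x + N y.
Proof. by move=> hx hy; rewrite -(nrmN hy); apply: nrmD => //; exact: hilN. Qed.

(** The l1 norm of the scalar is a crude constant, but it is all that
    continuity of the scaling needs. *)
Lemma nrmCZ c x : H x ->
  N (c *: x) <= (`|complex.Re c| + `|complex.Im c|) * N x.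
Proof.
move=> hx; rewrite {1}(complexE c) scalerDl -scalerA mulrDl.
apply: le_trans (nrmD _ _) _; [exact: HZ|by do 2!apply: HZ|].
by rewrite nrm_i !nrmRZ.
Qed.

Lemma nrm0 : N (0 : V) = 0.
Proof. by rewrite /nrm dot0l// sqrtr0. Qed.

Definition hclosure (P : set V) : set V :=
  [set x | H x /\ forall e : R, 0 < e -> exists2 y, P y & N (y - x) <= e].

Lemma hclosure_scale (P : set V) c x : P `<=` H -> (forall y, P y -> P (c *: y)) ->
  hclosure P x -> hclosure P (c *: x).
Proof.
move=> PH Pc [hx hP]; split; first exact: HZ.
move=> e e0; pose K := `|complex.Re c| + `|complex.Im c| + 1.
have K0 : 0 < K by rewrite ltr_wpDl// addr_ge0.
have [y Py hy] := hP _ (divr_gt0 e0 K0); exists (c *: y); first exact: Pc.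
rewrite -scalerBr; apply: le_trans (nrmCZ _ _) _; first exact: hilB (PH _ Py) _.
apply: (@le_trans _ _ (K * N (y - x))).
  by rewrite ler_wpM2r ?nrm_ge0// lerDl.
by rewrite mulrC -ler_pdivlMr.
Qed.

Lemma hclosure_add (P : set V) x y : P `<=` H -> (forall x y, P x -> P y -> P (x + y)) ->
  hclosure P x -> hclosure P y -> hclosure P (x + y).
Proof.
move=> PH PD [hx hPx] [hy hPy]; split; first exact: HD.
move=> e e0; have e2 : 0 < e / 2 by rewrite divr_gt0.
have [a Pa ha] := hPx _ e2; have [b Pb hb] := hPy _ e2.
exists (a + b); first exact: PD.
rewrite opprD addrACA; apply: le_trans (nrmD _ _) _; [exact: hilB (PH _ _) _..|].
by rewrite [leRHS](splitr e) lerD.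
Qed.

Lemma sub_hclosure (P : set V) x : H x -> P x -> hclosure P x.
Proof.
by move=> hx Px; split=> // e e0; exists x => //; rewrite subrr nrm0 ltW.
Qed.

Lemma hclosure_sum (P : set V) (I : finType) (F : I -> V) :
  P `<=` H -> P 0 -> (forall x y, P x -> P y -> P (x + y)) ->
  (forall i, hclosure P (F i)) -> hclosure P (\sum_i F i).
Proof.
move=> PH P0 PD h; apply: big_ind => [|x y|i _] //; first exact: sub_hclosure.
exact: hclosure_add.
Qed.

Lemma harmonic_bound (e : R) : 0 < e ->
  exists k0, forall k, (k0 <= k)%N -> k.+1%:R^-1 <= e.
Proof.
move=> e0; have /cvgrPdist_le/(_ _ e0)[k0 _ hk0] := @cvg_harmonic R.
by exists k0 => k /hk0 /=; rewrite sub0r normrN ger0_norm ?invr_ge0.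
Qed.

Lemma parallelogram x y : H x -> H y ->
  dot (x - y) (x - y) = 2 * dot x x + 2 * dot y y - dot (x + y) (x + y).
Proof.
move=> hx hy; have hs := HD hx hy; have hd := hilB hx hy.
rewrite dotBl// !dotBr// (dotDl hilb)// !dotDr//.
by move: (dot x x) (dot x y) (dot y x) (dot y y) => a b c d; ring.
Qed.

(** A minimizing sequence for the distance from [v] to [P] is Cauchy by the
    parallelogram identity, as the midpoint of two terms is again in [P].
    Near-minimality of the terms u k against u k + t x gives, in the limit,
    2 t dot (v - g) x <= t^2 dot x x for all t, so the linear coefficient
    vanishes. *)
Lemma projection (P : set V) v :
  P `<=` H -> P 0 -> (forall x y, P x -> P y -> P (x + y)) ->
  (forall t x, P x -> P (t%:C *: x)) -> H v ->
  exists2 g, hclosure P g & forall x, P x -> dot (v - g) x = 0.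
Proof.
move=> PH P0 PD PZ hv.
pose q x := dot (v - x) (v - x).
pose S := [set q x | x in P].
have q0 x : P x -> 0 <= q x.
  by move=> Px; apply: (dot_ge0 hilb); apply: hilB => //; exact: PH.
have S0 : has_inf S.
  by split; [exists (q 0), 0|exists 0 => _ [x Px <-]; exact: q0].
have lbS x : P x -> inf S <= q x.
  by move=> Px; apply: ge_inf; [case: S0|exists x].
have /choice[u hu] : forall k : nat, exists x, P x /\ q x <= inf S + k.+1%:R^-1.
  move=> k; have : (0 : R) < k.+1%:R^-1 by rewrite invr_gt0.
  by move=> /(inf_adherent)/(_ S0)[_ [x Px <-] hx]; exists x; split=> //; exact: ltW.
have Hu k : H (u k) by apply: PH; case: (hu k).
have Hvu k : H (v - u k) by apply: hilB.
have [g hg ug] : exists2 x, H x & forall e : R, 0 < e ->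
    exists k0, forall k, (k0 <= k)%N -> N (u k - x) <= e.
  apply: (hil_complete hilb) => // e e0.
  have e2 : 0 < e ^+ 2 / 4 by rewrite divr_gt0 ?exprn_gt0.
  have [k0 hk0] := harmonic_bound e2; exists k0 => m k /hk0 hm /hk0 hk.
  rewrite -ler_sqr ?nnegrE ?nrm_ge0 ?(ltW e0)// nrm_sqr; last exact: hilB.
  have -> : u m - u k = (v - u k) - (v - u m).
    by rewrite opprB addrACA [v + _]addrC addrACA addrN addr0 addrC.
  rewrite parallelogram//.
  have -> : (v - u k) + (v - u m) = 2%:C *: (v - (2^-1)%:C *: (u k + u m)).
    rewrite scalerBr scalerA -rmorphM mulfV// scale1r.
    by rewrite addrACA -opprD -[2]/(1+1) rmorphD scalerDl scale1r.
  have Pm : P ((2^-1)%:C *: (u k + u m)).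
    by apply: PZ; apply: PD; [case: (hu k)|case: (hu m)].
  have Hm := hilB hv (PH _ Pm).
  rewrite (dotZl hilb)//; last exact: HZ.
  rewrite dotZr//; move: (lbS _ Pm) (hu k).2 (hu m).2; rewrite /q.
  move: (dot _ _) (dot (v - u k) _) (dot (v - u m) _) (inf S) hm hk => a b c I.
  move: (m.+1%:R^-1) (k.+1%:R^-1) (e ^+ 2) => r1 r2 r3.
  lra.
exists g.
  split=> // e /ug[k0 hk0]; exists (u k0); first by case: (hu k0).
  exact: hk0.
move=> x Px; have hx := PH _ Px; have hvg := hilB hv hg.
have main t (e : R) : 0 < e -> 2 * t * dot (v - g) x <= t ^+ 2 * dot x x + e.
  move=> e0.
  (* Half of e pays for the defect of minimality at u k, half for
     replacing g by u k. *)
  pose K := 2 * `|t| * N x + 1.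
  have K0 : 0 < K by rewrite ltr_wpDl// !mulr_ge0// nrm_ge0.
  have e1 : 0 < e / (2 * K) by rewrite divr_gt0// mulr_gt0.
  have [k0 hk0] := ug _ e1.
  have [k1 hk1] := harmonic_bound (divr_gt0 e0 (ltr0Sn R 1) : 0 < e / 2).
  have := hk0 (maxn k0 k1) (leq_maxl _ _); have := hk1 (maxn k0 k1) (leq_maxr _ _).
  set k := maxn k0 k1 => h1 h2.
  have htx := HZ t%:C hx.
  have Pk : P (u k + t%:C *: x) by apply: PD; [case: (hu k)|apply: PZ].
  move: (lbS _ Pk) (hu k).2; rewrite /q opprD addrA.
  have hd := hilB (Hvu k) htx.
  rewrite [X in _ <= X]dotBl// !(dotBr (Hvu k) htx)//.
  rewrite !(dotZl hilb)// !dotZr// [dot x (v - u k)](dotC hilb) => h3 h4.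
  have h6 : 2 * t * dot (v - u k) x <= t ^+ 2 * dot x x + e / 2.
    move: h1 h3 h4; move: (dot (v - u k) _) (dot (v - u k) _) (dot x x) (inf S).
    move=> a b c d h1 h3 h4; move: h1 h3 h4; move: (e / 2) (k.+1%:R^-1) => e' r.
    rewrite expr2; lra.
  have hug := hilB (Hu k) hg.
  have h7 : dot (v - g) x = dot (v - u k) x + dot (u k - g) x.
    by rewrite -(dotDl hilb)// addrA subrK.
  have h5 := dot_le hug hx.
  have : 2 * t * dot (u k - g) x <= e / 2.
    apply: le_trans (ler_norm _) _; rewrite !normrM [`|2|]ger0_norm//.
    apply: (@le_trans _ _ (2 * `|t| * (e / (2 * K) * N x))).
      rewrite ler_wpM2l ?mulr_ge0//; apply: le_trans h5 _.
      by rewrite ler_wpM2r// nrm_ge0.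
    have -> : 2 * `|t| * (e / (2 * K) * N x) = (2 * `|t| * N x) / K * (e / 2).
      by field; rewrite gt_eqF.
    rewrite ler_piMl// ?divr_ge0 ?ltW//.
    by rewrite ltr_pdivrMr// mul1r /K ltrDl.
  by rewrite h7; lra.
apply/eqP; rewrite -sqrf_eq0 eq_le sqr_ge0 andbT.
have := @discriminant_le _ 0 (- dot (v - g) x) (dot x x).
rewrite sqrrN mul0r; apply; last exact: (dot_ge0 hilb).
move=> t; have : 2 * t * dot (v - g) x <= t ^+ 2 * dot x x.
  by apply/ler_addgt0Pr => e; exact: main.
lra.
Qed.

(** * Ranges and their orthogonal complements *)

Section Defect.
Variable D : set V.
Hypothesis D0 : D 0.
Hypothesis DD : forall x y, D x -> D y -> D (x + y).
Hypothesis DZ : forall c x, D x -> D (c *: x).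

Definition linear_on (S : V -> V) :=
  (forall x, D x -> H (S x)) /\
  (forall x y, D x -> D y -> S (x + y) = S x + S y) /\
  (forall c x, D x -> S (c *: x) = c *: S x).

(** Orthogonality of the real parts suffices, since the range of a
    complex-linear map is stable under i; see [perp_ran_scale]. *)
Definition perp_ran (S : V -> V) : set V :=
  [set h | H h /\ forall x, D x -> dot (S x) h = 0].

Definition ran (S : V -> V) : set V := [set S x | x in D].

Lemma ran_lin S : linear_on S -> [/\ ran S `<=` H, ran S 0,
  forall x y, ran S x -> ran S y -> ran S (x + y) &
  forall c x, ran S x -> ran S (c *: x)].
Proof.
move=> [SH [SD SZ]]; split.
- by move=> _ [x Dx <-]; exact: SH.
- by exists 0; [exact: D0|have := SZ 0 0 D0; rewrite !scale0r].
- by move=> _ _ [x Dx <-] [y Dy <-]; exists (x + y); [exact: DD|exact: SD].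
- by move=> c _ [x Dx <-]; exists (c *: x); [exact: DZ|exact: SZ].
Qed.

Lemma perp_ran_add S x y : linear_on S -> perp_ran S x -> perp_ran S y ->
  perp_ran S (x + y).
Proof.
move=> [SH _] [hx px] [hy py]; split; first exact: HD.
by move=> z Dz; rewrite dotDr ?px ?py ?addr0//; exact: SH.
Qed.

Lemma perp_ran_scale S c x : linear_on S -> perp_ran S x -> perp_ran S (c *: x).
Proof.
move=> [SH [SD SZ]] [hx px]; split; first exact: HZ.
move=> z Dz; rewrite {1}(complexE c) scalerDl -scalerA.
have h := SH _ Dz; have hix := HZ (complex.Im c)%:C hx.
rewrite dotDr//; [|exact: HZ..].
rewrite dotZr// px// mulr0 add0r -[dot _ _]opprK -dot_iN// -SZ//.
by rewrite dotZr ?px ?mulr0 ?oppr0//; [exact: DZ|apply: SH; exact: DZ].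
Qed.

Lemma perp_ran_sum S (I : finType) (F : I -> V) : linear_on S ->
  (forall i, perp_ran S (F i)) -> perp_ran S (\sum_i F i).
Proof.
move=> lS h; apply: big_ind => [|x y|] //; last exact: perp_ran_add.
by split=> // x Dx; rewrite (dotC hilb) dot0l//; apply: lS.1.
Qed.

Lemma ran_decomposition S v : linear_on S -> H v ->
  exists2 g, hclosure (ran S) g & perp_ran S (v - g).
Proof.
move=> lS hv; have [rH r0 rD rZ] := ran_lin lS.
have [|g cg pg] := projection rH r0 rD _ hv; first by move=> t; exact: rZ.
exists g => //; split; first by apply: hilB => //; case: cg.
by move=> x Dx; rewrite (dotC hilb); apply: pg; exists x.
Qed.

(** If h is the limit of S1 x_k and is orthogonal to all S2 x_k, then |h|^2 is
    the limit of <(S1 - S2) x_k, h>, which is at most b |h|^2. *)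
Lemma hclosure_ran_perp_ran (S1 S2 : V -> V) (b : R) : linear_on S1 -> linear_on S2 ->
  0 <= b < 1 -> (forall x, D x -> N (S1 x - S2 x) <= b * N (S1 x)) ->
  forall h, hclosure (ran S1) h -> perp_ran S2 h -> h = 0.
Proof.
move=> [SH1 _] [SH2 _] /andP[b0 b1] hb h [hh ch] [_ ph].
apply: nrm_eq0 => //; apply/eqP; rewrite eq_le nrm_ge0 andbT.
have [->//|h0] := eqVneq (N h) 0.
have hp : 0 < N h by rewrite lt_neqAle eq_sym h0 nrm_ge0.
have main (e : R) : 0 < e -> (1 - b) * N h <= 2 * e.
  move=> e0; have [_ [x Dx <-] hx] := ch e e0.
  have h1 := SH1 _ Dx; have h2 := SH2 _ Dx.
  have h12 := hilB h1 h2; have h1h := hilB h1 hh.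
  have e1 : dot h h = dot (S1 x - S2 x) h - dot (S1 x - h) h.
    rewrite -dotBl//.
    have -> : S1 x - S2 x - (S1 x - h) = h - S2 x.
      by rewrite opprB addrC addrA subrK.
    by rewrite dotBl// (ph _ Dx) subr0.
  have l1 : N (S1 x) <= N h + e.
    rewrite -(subrK h (S1 x)); apply: le_trans (nrmD h1h hh) _.
    by rewrite addrC lerD2l.
  have l2 := dot_le h12 hh; have l3 := dot_le h1h hh.
  have l4 : N (S1 x - S2 x) <= b * (N h + e).
    by apply: le_trans (hb _ Dx) _; rewrite ler_wpM2l.
  have l5 : dot h h <= (b * (N h + e) + e) * N h.
    rewrite e1 mulrDl; apply: lerD.
      by apply: le_trans (ler_norm _) (le_trans l2 _); rewrite ler_wpM2r ?nrm_ge0.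
    rewrite -normrN in l3.
    by apply: le_trans (ler_norm _) (le_trans l3 _); rewrite ler_wpM2r ?nrm_ge0.
  move: l5; rewrite -nrm_sqr// expr2 ler_pM2r// => l5.
  have : b * e <= e by rewrite ler_piMl// ltW.
  lra.
rewrite -(@pmulr_rle0 _ (1 - b)) ?subr_gt0//.
apply/ler_addgt0Pr => e e0; rewrite add0r.
by have := main (e / 2) (divr_gt0 e0 (ltr0Sn R 1)); lra.
Qed.

(** Dimensions are compared through the sizes of free families, so that
    infinite deficiency indices need no separate treatment. *)
Definition has_lin_indep (P : set V) k :=
  exists v : 'I_k -> V, (forall i, P (v i)) /\
    forall c : 'I_k -> R[i], \sum_i c i *: v i = 0 -> forall i, c i = 0.

(** Project the vectors v i to the orthogonal complement of the range of [S1].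
    A relation between the projections puts the corresponding combination of
    the v i into the closure of the range of [S1], where
    [hclosure_ran_perp_ran] forces it to vanish. *)
Lemma perp_ran_transfer (S1 S2 : V -> V) (b : R) : linear_on S1 -> linear_on S2 ->
  0 <= b < 1 -> (forall x, D x -> N (S1 x - S2 x) <= b * N (S1 x)) ->
  forall k, has_lin_indep (perp_ran S2) k -> has_lin_indep (perp_ran S1) k.
Proof.
move=> l1 l2 b01 hb k [v [pv iv]].
have /choice[g hg] : forall i, exists g, hclosure (ran S1) g /\ perp_ran S1 (v i - g).
  by move=> i; have [g] := ran_decomposition l1 (pv i).1; exists g.
exists (fun i => v i - g i); split=> [i|c]; first by case: (hg i).
under eq_bigr do rewrite scalerBr.
rewrite big_split /= sumrN => /subr0_eq e; apply: iv.
apply: (hclosure_ran_perp_ran l1 l2 b01 hb); last first.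
  by apply: perp_ran_sum => // i; exact: perp_ran_scale.
have [rH r0 rD rZ] := ran_lin l1.
rewrite e; apply: hclosure_sum => // i; apply: hclosure_scale => //; last by case: (hg i).
exact: rZ.
Qed.

End Defect.
End HilbertSpace.

Arguments linear_on {R V} H D S.
Arguments perp_ran {R V} H dot D S _.
Arguments hclosure {R V} H dot P _.

(** * Symmetric operators *)

Section SymmetricOperators.
Context {R : realType} {V : lmodType R[i]} {H : set V} {dot : V -> V -> R}.
Hypothesis hilb : hilbert H dot.
Variable D : set V.
Hypothesis DH : D `<=` H.
Hypothesis D0 : D 0.
Hypothesis DD : forall x y, D x -> D y -> D (x + y).
Hypothesis DZ : forall c x, D x -> D (c *: x).
Implicit Types (x y z : V) (t : R) (c sigma : R[i]) (S : V -> V).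
Let HD := hilD hilb.
Let HZ := hilZ hilb.
Local Notation "'N'" := (nrm dot).
Local Notation linear_on := (linear_on H D).
Local Notation perp_ran := (perp_ran H dot D).

Lemma domB x y : D x -> D y -> D (x - y).
Proof. by move=> Dx Dy; apply: DD => //; rewrite -scaleN1r; apply: DZ. Qed.

Definition symmetric_on S :=
  linear_on S /\ forall x y, D x -> D y -> dot (S x) y = dot x (S y).

Definition translate S sigma x := S x + sigma *: x.

Lemma linear_translate S sigma : linear_on S -> linear_on (translate S sigma).
Proof.
move=> [SH [SD SZ]]; rewrite /translate; split; [|split].
- by move=> x Dx; apply: HD; [exact: SH|apply: HZ; exact: DH].
- by move=> x y Dx Dy; rewrite SD// scalerDr addrACA.
- by move=> c x Dx; rewrite SZ// scalerDr !scalerA mulrC.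
Qed.

Lemma linear_onB S x y : linear_on S -> D x -> D y -> S (x - y) = S x - S y.
Proof.
move=> [SH [SD SZ]] Dx Dy; have Dy' := DZ (-1) Dy.
by rewrite -scaleN1r SD// SZ// scaleN1r.
Qed.

(** Equivalently, the quadratic form <S x, x> is real. *)
Lemma symmetric_i S x : symmetric_on S -> D x -> dot (S x) ('i *: x) = 0.
Proof.
move=> [[SH [SD SZ]] sS] Dx.
have h1 := SH _ Dx; have h2 := DH Dx.
have : dot (S x) ('i *: x) = - dot (S x) ('i *: x).
  rewrite {1}sS//; last exact: DZ.
  by rewrite SZ//; have := dot_iN hilb h2 h1; rewrite (dotC hilb ('i *: x)) => ->; rewrite opprK.
by move=> e; lra.
Qed.

Definition imag_unit sigma := sigma = 'i \/ sigma = - 'i.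

Lemma imag_unitN sigma : imag_unit sigma -> imag_unit (- sigma).
Proof. by case=> ->; [right|left; rewrite opprK]. Qed.

Lemma dot_unitN sigma x y : imag_unit sigma -> H x -> H y ->
  dot (sigma *: x) y = - dot x (sigma *: y).
Proof.
move=> su hx hy; have hix := HZ 'i hx; have hiy := HZ 'i hy.
case: su => ->; first exact: (dot_iN hilb).
by rewrite !scaleNr (dotNl hilb)// (dotNr hilb)// (dot_iN hilb).
Qed.

Lemma dot_unit2 sigma x : imag_unit sigma -> H x ->
  dot (sigma *: x) (sigma *: x) = dot x x.
Proof.
move=> su hx; have hix := HZ 'i hx.
case: su => ->; first exact: (dot_i2 hilb).
by rewrite !scaleNr (dotNl hilb) ?(dotNr hilb) ?opprK ?(dot_i2 hilb)//; apply: (hilN hilb).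
Qed.

(** The cross terms cancel by [symmetric_i]. *)
Lemma symmetric_nrm S sigma x : symmetric_on S -> imag_unit sigma -> D x ->
  N (translate S sigma x) ^+ 2 = N (S x) ^+ 2 + N x ^+ 2.
Proof.
move=> sS su Dx; have h1 := sS.1.1 _ Dx; have h2 := DH Dx; have h3 := HZ sigma h2.
have e0 : dot (S x) (sigma *: x) = 0.
  have := symmetric_i sS Dx; have hix := HZ 'i h2.
  by case: su => -> // e; rewrite scaleNr (dotNr hilb)// e oppr0.
rewrite (nrm_sqr hilb); last exact: HD.
rewrite !(nrm_sqr hilb)// -(dot_unit2 su h2) /translate.
have h4 := HD h1 h3.
rewrite (dotDl hilb)// !(dotDr hilb)// [dot (sigma *: x) (S x)](dotC hilb) e0.
by rewrite addr0 add0r.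
Qed.

Lemma symmetric_le S sigma x : symmetric_on S -> imag_unit sigma -> D x ->
  N x <= N (translate S sigma x) /\ N (S x) <= N (translate S sigma x).
Proof.
move=> sS su Dx; have := symmetric_nrm sS su Dx => e.
by split; rewrite -ler_sqr ?nnegrE ?(nrm_ge0)// e ?lerDr ?lerDl sqr_ge0.
Qed.

(** * Stability of the defect under relatively bounded perturbations *)

Section Perturbation.
Variables (S0 S1 : V -> V) (a C : R).
Hypotheses (sym0 : symmetric_on S0) (sym1 : symmetric_on S1).
Hypotheses (a01 : 0 <= a < 1) (C0 : 0 <= C).
Hypothesis rel : forall x, D x -> N (S1 x - S0 x) <= a * N (S0 x) + C * N x.

Definition path t x := S0 x + t%:C *: (S1 x - S0 x).

Lemma path_symmetric t : symmetric_on (path t).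
Proof.
have [[SH0 [SD0 SZ0]] ss0] := sym0; have [[SH1 [SD1 SZ1]] ss1] := sym1.
have h10 x : D x -> H (S1 x - S0 x).
  by move=> Dx; apply: (hilB hilb); [exact: SH1|exact: SH0].
split; first split; [|split|].
- by move=> x Dx; apply: HD; [exact: SH0|apply: HZ; exact: h10].
- move=> x y Dx Dy; rewrite /path SD0// SD1//.
  by rewrite opprD addrACA scalerDr addrACA.
- by move=> c x Dx; rewrite /path SZ0// SZ1// -scalerBr [RHS]scalerDr !scalerA mulrC.
- move=> x y Dx Dy; have hx := DH Dx; have hy := DH Dy.
  have := (SH0 _ Dx, SH0 _ Dy); have := (SH1 _ Dx, SH1 _ Dy).
  have := (h10 _ Dx, h10 _ Dy) => -[h1 h2] [h3 h4] [h5 h6].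
  have h7 := HZ t%:C h1; have h8 := HZ t%:C h2; rewrite /path.
  rewrite (dotDl hilb)// (dotDr hilb)// (dotZl hilb)// (dotZr hilb)//.
  by rewrite (dotBl hilb)// (dotBr hilb)// ss0// ss1.
Qed.

(** The bound is relative to S0; replacing S0 by S_t costs t |S1 x - S0 x|,
    which is absorbed on the left because a t <= a < 1.  The constant does not
    depend on [t], which is what allows steps of uniform length. *)
Lemma path_rel t sigma x : 0 <= t <= 1 -> imag_unit sigma -> D x ->
  N (S1 x - S0 x) <= (a + C) / (1 - a) * N (translate (path t) sigma x).
Proof.
move=> /andP[t0 t1] su Dx; have /andP[a0 a1] := a01.
have [n1 n2] := symmetric_le (path_symmetric t) su Dx.
have h1 := sym1.1.1 _ Dx; have h0 := sym0.1.1 _ Dx; have hd := hilB hilb h1 h0.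
have ht := (path_symmetric t).1.1 _ Dx.
have n3 : N (S0 x) <= N (path t x) + N (S1 x - S0 x).
  have e : S0 x = path t x - t%:C *: (S1 x - S0 x) by rewrite addrK.
  rewrite {1}e.
  apply: le_trans (nrmB hilb ht (HZ _ hd)) _; rewrite lerD2l (nrmRZ hilb)//.
  by rewrite ger0_norm// ler_piMl ?nrm_ge0.
have n4 := rel Dx.
rewrite mulrAC ler_pdivlMr ?subr_gt0//.
have m1 := ler_wpM2l a0 n3; have m2 := ler_wpM2l a0 n2; have m3 := ler_wpM2l C0 n1.
move: (N _) (N _) (N _) (N _) (N _) m1 m2 m3 n4 => Z Y X W U; lra.
Qed.

Lemma linear_path t sigma : linear_on (translate (path t) sigma).
Proof. by apply: linear_translate; exact: (path_symmetric t).1. Qed.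

Lemma path_step t s sigma x :
  translate (path t) sigma x - translate (path s) sigma x = (t - s)%:C *: (S1 x - S0 x).
Proof.
rewrite /translate /path opprD addrACA subrr addr0 opprD addrACA subrr add0r.
by rewrite -scalerBl rmorphB.
Qed.

(** Only the distance between [s] and [t] matters, so each step can be taken in
    both directions. *)
Lemma path_transfer t s sigma k : imag_unit sigma ->
  0 <= s <= 1 -> `|t - s| * ((a + C) / (1 - a)) < 1 ->
  has_lin_indep (perp_ran (translate (path t) sigma)) k ->
  has_lin_indep (perp_ran (translate (path s) sigma)) k.
Proof.
move=> su s01 ts; have /andP[a0 a1] := a01.
apply: (perp_ran_transfer hilb D0 DD DZ (b := `|t - s| * ((a + C) / (1 - a)))).
- exact: linear_path.
- exact: linear_path.
- rewrite ts andbT; apply: mulr_ge0 => //; apply: divr_ge0.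
    exact: addr_ge0.
  by rewrite subr_ge0 ltW.
- move=> x Dx; rewrite path_step (nrmRZ hilb); last first.
    by apply: (hilB hilb); [exact: sym1.1.1|exact: sym0.1.1].
  rewrite distrC -mulrA; apply: ler_wpM2l => //; exact: path_rel.
Qed.

Lemma defect_transfer sigma k : imag_unit sigma ->
  has_lin_indep (perp_ran (translate S0 sigma)) k <->
  has_lin_indep (perp_ran (translate S1 sigma)) k.
Proof.
move=> su; pose M := (a + C) / (1 - a).
have M0 : 0 <= M
  by have /andP[a0 a1] := a01; apply: divr_ge0; rewrite ?subr_ge0 ?(ltW a1)// addr_ge0.
(* Steps of length 1 / K < 1 / M are short enough for [path_transfer]. *)
pose K := (Num.truncn M).+1.
have MK : M < K%:R by exact: truncnS_gt.
have K0 : 0 < K%:R :> R by rewrite ltr0n.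
pose t j : R := j%:R / K%:R.
have t01 j : (j <= K)%N -> 0 <= t j <= 1.
  by move=> jK; rewrite divr_ge0// ler_pdivrMr// mul1r ler_nat.
have st j : t j.+1 - t j = K%:R^-1.
  by rewrite /t -mulrBl -natrB// subSnn mul1r.
have step j : (j < K)%N ->
    has_lin_indep (perp_ran (translate (path (t j)) sigma)) k <->
    has_lin_indep (perp_ran (translate (path (t j.+1)) sigma)) k.
  move=> jK; have e : K%:R^-1 * M < 1 by rewrite mulrC ltr_pdivrMr// mul1r.
  split; apply: path_transfer => //; [exact: t01| |exact/t01/ltnW|].
    by rewrite distrC st ger0_norm// invr_ge0 ltW.
  by rewrite st ger0_norm// invr_ge0 ltW.
have all j : (j <= K)%N ->
    has_lin_indep (perp_ran (translate (path (t 0)) sigma)) k <->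
    has_lin_indep (perp_ran (translate (path (t j)) sigma)) k.
  elim: j => [//|j IH] jK; apply: iff_trans (step j jK); exact: IH (ltnW jK).
have := all K (leqnn _).
have -> : path (t 0) = S0.
  by apply/funext => x; rewrite /path /t mul0r rmorph0 scale0r addr0.
have -> // : path (t K) = S1.
by apply/funext => x; rewrite /path /t divff ?gt_eqF// rmorph1 scale1r addrC subrK.
Qed.

End Perturbation.

(** * Closures and adjoints *)

Definition graph_closure S : set (V * V) :=
  [set fg | H fg.1 /\ H fg.2 /\ forall e : R, 0 < e ->
     exists x, [/\ D x, N (x - fg.1) <= e & N (S x - fg.2) <= e]].

Definition adjoint S : set (V * V) :=
  [set gh | H gh.1 /\ H gh.2 /\ forall x, D x -> dot (S x) gh.1 = dot x gh.2].

Lemma cauchy_dominated (u : nat -> V) (c : R) : (forall k, H (u k)) ->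
  (forall m k, N (u m - u k) <= c * (m.+1%:R^-1 + k.+1%:R^-1)) ->
  exists2 x, H x & forall e : R, 0 < e -> exists k0, forall k, (k0 <= k)%N ->
    N (u k - x) <= e.
Proof.
move=> hu hc; apply: (hil_complete hilb) => // e e0.
pose c' := `|c| + 1; have c0 : 0 < c' by rewrite ltr_wpDl.
have e1 : 0 < e / (2 * c') by rewrite divr_gt0// mulr_gt0.
have [k0 hk0] := harmonic_bound e1; exists k0 => m k /hk0 hm /hk0 hk.
apply: le_trans (hc m k) _.
apply: (@le_trans _ _ (c' * (m.+1%:R^-1 + k.+1%:R^-1))).
  rewrite ler_wpM2r ?addr_ge0 ?invr_ge0//.
  by apply: le_trans (ler_norm _) _; rewrite lerDl.
have -> : e = c' * (e / (2 * c') + e / (2 * c')) by field; rewrite gt_eqF.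
by rewrite ler_wpM2l ?lerD// ltW.
Qed.

Lemma graph_closure_seq S f g : linear_on S -> graph_closure S (f, g) ->
  exists u : nat -> V, [/\ forall k, D (u k), forall k, N (u k - f) <= k.+1%:R^-1 &
    forall k, N (S (u k) - g) <= k.+1%:R^-1].
Proof.
move=> lS [hf [hg hc]].
have /choice[u hu] : forall k : nat, exists x,
    [/\ D x, N (x - f) <= k.+1%:R^-1 & N (S x - g) <= k.+1%:R^-1].
  by move=> k; apply: hc; rewrite invr_gt0.
by exists u; split=> k; case: (hu k).
Qed.

Lemma nrm_dist3 x y z : H x -> H y -> H z -> N (x - y) <= N (x - z) + N (y - z).
Proof.
move=> hx hy hz; rewrite [N (y - z)](nrmBC hilb)//.
have -> : x - y = (x - z) + (z - y) by rewrite addrA subrK.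
by apply: (nrmD hilb); apply: (hilB hilb).
Qed.

Lemma nrm_le_dist x y : H x -> H y -> N x <= N y + N (x - y).
Proof.
move=> hx hy; have e : x = y + (x - y) by rewrite addrC subrK.
rewrite {1}e; apply: (nrmD hilb) => //.
exact: (hilB hilb).
Qed.

(** Domination of the graph norms passes to the closures: the images under
    [S'] of an approximating sequence are Cauchy.  The bound on g' is kept,
    since the compactness argument needs it. *)
Lemma graph_closure_dom S S' (al be : R) f g : linear_on S -> linear_on S' ->
  0 <= al -> 0 <= be ->
  (forall x, D x -> N (S' x) <= al * N (S x) + be * N x) -> graph_closure S (f, g) ->
  exists2 g', graph_closure S' (f, g') & N g' <= al * N g + be * N f.
Proof.
move=> lS lS' al0 be0 hS cS; have [hf [hg _]] := cS.
have [u [Du uf ug]] := graph_closure_seq lS cS; rewrite /= in hf hg.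
have [SH [SD SZ]] := lS; have [SH' [SD' SZ']] := lS'.
have Hu k : H (u k) by exact: DH.
have bnd m k : N (S' (u m) - S' (u k)) <= (al + be) * (m.+1%:R^-1 + k.+1%:R^-1).
  rewrite -linear_onB//; apply: le_trans (hS _ _) _; first exact: domB.
  rewrite linear_onB// mulrDl lerD// ler_wpM2l//.
    apply: le_trans (nrm_dist3 (SH _ (Du m)) (SH _ (Du k)) hg) _.
    exact: lerD.
  by apply: le_trans (nrm_dist3 (Hu m) (Hu k) hf) _; exact: lerD.
have [g' hg' ug'] := cauchy_dominated (fun k => SH' _ (Du k)) bnd.
exists g'.
  split=> //; split=> // e e0.
  have [k0 hk0] := ug' e e0; have [k1 hk1] := harmonic_bound e0.
  exists (u (maxn k0 k1)); split=> //=.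
    by apply: le_trans (uf _) (hk1 _ _); rewrite leq_maxr.
  by apply: hk0; rewrite leq_maxl.
suff main (e : R) : 0 < e -> N g' <= al * N g + be * N f + e.
  by apply/ler_addgt0Pr => e; exact: main.
move=> e0.
pose c := 1 + al + be; have c0 : 0 < c by rewrite /c -addrA ltr_wpDr// addr_ge0.
have e1 : 0 < e / c by rewrite divr_gt0.
have [k0 hk0] := ug' _ e1; have [k1 hk1] := harmonic_bound e1.
have := hk0 (maxn k0 k1) (leq_maxl _ _); have := hk1 (maxn k0 k1) (leq_maxr _ _).
move: (maxn k0 k1) => k h1 h2.
have b1 := nrm_le_dist hg' (SH' _ (Du k)); rewrite (nrmBC hilb) in b1 => //; last exact: SH'.
have b2 := nrm_le_dist (Hu k) hf; have b3 := nrm_le_dist (SH _ (Du k)) hg.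
have b4 := hS _ (Du k).
have b5 : N (S (u k)) <= N g + e / c by apply: le_trans b3 _; rewrite lerD2l (le_trans (ug k)).
have b6 : N (u k) <= N f + e / c by apply: le_trans b2 _; rewrite lerD2l (le_trans (uf k)).
have b7 := ler_wpM2l al0 b5; have b8 := ler_wpM2l be0 b6.
have b9 : e = e / c + al * (e / c) + be * (e / c) by rewrite /c; field; rewrite gt_eqF.
rewrite b9; move: (N g') (N (S' (u k))) (N _) (N (u k)) (N g) (N f) (e / c) b1 h2 b4 b7 b8.
move=> A1 A2 A3 A4 A5 A6 A7; lra.
Qed.

Lemma eps_eq0 (x K : R) : (forall e : R, 0 < e -> `|x| <= e * K) -> x = 0.
Proof.
move=> h; apply/normr0_eq0/eqP; rewrite eq_le normr_ge0 andbT.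
have K0 : 0 <= K by have := h 1 ltr01; rewrite mul1r; apply: le_trans.
apply/ler_addgt0Pr => e e0; rewrite add0r.
have K1 : 0 < K + 1 by rewrite ltr_wpDl.
apply: le_trans (h (e / (K + 1)) (divr_gt0 e0 K1)) _.
by rewrite mulrAC ler_pdivrMr// ler_wpM2l ?(ltW e0)// lerDl.
Qed.

Lemma nrm_unit sigma x : imag_unit sigma -> H x -> N (sigma *: x) = N x.
Proof. by move=> su hx; rewrite /nrm dot_unit2. Qed.

Lemma graph_closure_sub S f g f' g' : linear_on S ->
  graph_closure S (f, g) -> graph_closure S (f', g') ->
  graph_closure S (f - f', g - g').
Proof.
move=> lS [hf [hg c]] [hf' [hg' c']]; rewrite /= in hf hg hf' hg' c c'.
split; first exact: (hilB hilb). split; first exact: (hilB hilb).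
move=> e e0; have e2 : 0 < e / 2 by rewrite divr_gt0.
have [x [Dx xf xg]] := c _ e2; have [y [Dy yf yg]] := c' _ e2.
have hx := DH Dx; have hy := DH Dy; have hSx := lS.1 _ Dx; have hSy := lS.1 _ Dy.
exists (x - y); split=> /=; first exact: domB.
  have -> : x - y - (f - f') = (x - f) - (y - f').
    by rewrite !opprB addrACA [RHS]addrACA [- y - f]addrC.
  apply: le_trans (nrmB hilb (hilB hilb hx hf) (hilB hilb hy hf')) _.
  by rewrite [leRHS](splitr e) lerD.
rewrite linear_onB//.
have -> : S x - S y - (g - g') = (S x - g) - (S y - g').
  by rewrite !opprB addrACA [RHS]addrACA [- S y - g]addrC.
apply: le_trans (nrmB hilb (hilB hilb hSx hg) (hilB hilb hSy hg')) _.
by rewrite [leRHS](splitr e) lerD.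
Qed.

Lemma adjoint_graph_closure S f f' g h : linear_on S ->
  adjoint S (g, h) -> graph_closure S (f, f') ->
  dot f' g = dot f h.
Proof.
move=> lS [hg [hh aS]] [hf [hf' cS]]; rewrite /= in hg hh aS hf hf' cS.
apply/eqP; rewrite -subr_eq0; apply/eqP; apply: (@eps_eq0 _ (N g + N h)) => e e0.
have [x [Dx xf xf']] := cS e e0.
have hx := DH Dx; have hSx := lS.1 _ Dx.
have h1 := hilB hilb hSx hf'; have h2 := hilB hilb hx hf.
have -> : dot f' g - dot f h = dot (x - f) h - dot (S x - f') g.
  rewrite (dotBl hilb hx hf hh) (dotBl hilb hSx hf' hg) (aS _ Dx).
  by move: (dot _ _) (dot _ _) (dot _ _) => a b c; ring.
apply: le_trans (ler_normB _ _) _; rewrite mulrDr addrC; apply: lerD.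
  apply: le_trans (dot_le hilb h1 hg) _; by rewrite ler_wpM2r ?nrm_ge0.
apply: le_trans (dot_le hilb h2 hh) _; by rewrite ler_wpM2r ?nrm_ge0.
Qed.

Lemma adjoint_i S g h : linear_on S -> adjoint S (g, h) -> adjoint S ('i *: g, 'i *: h).
Proof.
move=> lS [hg [hh aS]]; rewrite /= in hg hh aS.
split; first exact: HZ. split; first exact: HZ.
move=> x Dx /=; have hx := DH Dx; have hSx := lS.1 _ Dx; have Dix := DZ 'i Dx.
apply: oppr_inj; rewrite -(dot_iN hilb hSx hg) -(dot_iN hilb hx hh) -aS//.
by rewrite lS.2.2.
Qed.

Lemma graph_closure_adj S fg : symmetric_on S -> graph_closure S fg -> adjoint S fg.
Proof.
case: fg => f g [lS sS] cS; have [hf [hg cf]] := cS; split=> //; split=> // x Dx /=.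
have hx := DH Dx; have hSx := lS.1 _ Dx; rewrite /= in hf hg cf.
have ax : adjoint S (x, S x).
  by split=> //; split=> // y Dy; exact: sS.
rewrite [dot x g](dotC hilb) [dot _ f](dotC hilb); apply/esym.
exact: adjoint_graph_closure ax cS.
Qed.

(** The estimate [symmetric_le] in the limit. *)
Lemma graph_closure_le S sigma f g : symmetric_on S -> imag_unit sigma -> graph_closure S (f, g) ->
  N f <= N (g + sigma *: f) /\ N g <= N (g + sigma *: f).
Proof.
move=> sS su [hf [hg cS]]; rewrite /= in hf hg cS.
have hgf := HD hg (HZ sigma hf).
have main (e : R) : 0 < e ->
    N f <= N (g + sigma *: f) + e /\ N g <= N (g + sigma *: f) + e.
  move=> e0; have e3 : 0 < e / 3 by rewrite divr_gt0.
  have [x [Dx xf xg]] := cS _ e3.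
  have hx := DH Dx; have hSx := sS.1.1 _ Dx.
  have [n1 n2] := symmetric_le sS su Dx.
  have h1 := hilB hilb hx hf; have h2 := hilB hilb hSx hg.
  have n3 : N (translate S sigma x) <= N (g + sigma *: f) + (N (S x - g) + N (x - f)).
    rewrite -(nrm_unit su h1).
    have -> : translate S sigma x = (g + sigma *: f) + ((S x - g) + sigma *: (x - f)).
      rewrite /translate scalerBr addrACA; congr (_ + _).
        by rewrite addrC subrK.
      by rewrite addrC subrK.
    have h3 := HZ sigma h1; have h4 := HD h2 h3.
    apply: le_trans (nrmD hilb hgf h4) _; rewrite lerD2l; exact: (nrmD hilb).
  have n4 : N f <= N x + N (x - f).
    by rewrite (nrmBC hilb)//; exact: nrm_le_dist.
  have n5 : N g <= N (S x) + N (S x - g).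
    by rewrite (nrmBC hilb)//; exact: nrm_le_dist.
  move: (N f) (N g) (N x) (N (S x)) (N _) (N _) (N (x - f)) (N (S x - g)) n1 n2 n3 n4 n5 xf xg => *.
  by split; lra.
by split; apply/ler_addgt0Pr => e /main[].
Qed.

Lemma graph_closure_inj S sigma f g f' g' : symmetric_on S -> imag_unit sigma ->
  graph_closure S (f, g) -> graph_closure S (f', g') -> g + sigma *: f = g' + sigma *: f' -> f = f'.
Proof.
move=> sS su c c' e; have cs := graph_closure_sub sS.1 c c'.
have [n1 _] := graph_closure_le sS su cs.
apply/subr0_eq; apply: (nrm_eq0 hilb); first by apply: (hilB hilb); [case: c|case: c'].
apply/eqP; rewrite eq_le (nrm_ge0) andbT; apply: le_trans n1 _.
by rewrite scalerBr addrACA -opprD e subrr (nrm0 hilb).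
Qed.

(** Density of the range of S + sigma turns into surjectivity for the closure:
    by [symmetric_le], preimages of a convergent sequence are Cauchy. *)
Lemma graph_closure_surj S sigma u : symmetric_on S -> imag_unit sigma ->
  (forall h, perp_ran (translate S sigma) h -> h = 0) -> H u ->
  exists f g, graph_closure S (f, g) /\ u = g + sigma *: f.
Proof.
move=> sS su p0 hu; have lS := sS.1; have lP := linear_translate sigma lS.
have [v cv /p0/subr0_eq uv] := ran_decomposition hilb D0 DD DZ lP hu.
move: cv; rewrite -uv => -[_ cu].
have /choice[x hx] : forall k : nat, exists x, D x /\ N (translate S sigma x - u) <= k.+1%:R^-1.
  move=> k; have [|_ [x Dx <-] hx] := cu k.+1%:R^-1; first by rewrite invr_gt0.
  by exists x.
have Hx k : H (x k) by apply: DH; case: (hx k).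
have Hp k : H (translate S sigma (x k)) by apply: lP.1; case: (hx k).
have bnd m k : N (x m - x k) <= 1 * (m.+1%:R^-1 + k.+1%:R^-1).
  have Dd : D (x m - x k) by apply: domB; [case: (hx m)|case: (hx k)].
  apply: le_trans (symmetric_le sS su Dd).1 _; rewrite mul1r.
  rewrite (linear_onB lP); [|by case: (hx m)|by case: (hx k)].
  apply: le_trans (nrm_dist3 (Hp m) (Hp k) hu) _; apply: lerD; [by case: (hx m)|by case: (hx k)].
have [f hf xf] := cauchy_dominated Hx bnd.
have hsf := HZ sigma hf.
exists f, (u - sigma *: f); split; last by rewrite subrK.
split=> //=; split; first exact: (hilB hilb).
move=> e e0; have e2 : 0 < e / 2 by rewrite divr_gt0.
have [k0 hk0] := xf _ e2; have [k1 hk1] := harmonic_bound e2.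
have n1 := hk0 (maxn k0 k1) (leq_maxl _ _); have n2 := hk1 (maxn k0 k1) (leq_maxr _ _).
move: (maxn k0 k1) n1 n2 => k n1 n2; have [Dk n3] := hx k.
exists (x k); split=> //; first by apply: le_trans n1 _; rewrite ler_pdivrMr// ler_pMr// ler1n.
have h1 := hilB hilb (Hx k) hf; have h2 := hilB hilb (Hp k) hu.
have -> : S (x k) - (u - sigma *: f) = (translate S sigma (x k) - u) - sigma *: (x k - f).
  rewrite /translate scalerBr !opprB [S _ + _ - u]addrAC -[RHS]addrA.
  by rewrite [sigma *: x k + _]addrC subrK addrA addrAC.
apply: le_trans (nrmB hilb h2 (HZ sigma h1)) _; rewrite (nrm_unit su h1).
rewrite [leRHS](splitr e); apply: lerD => //; exact: le_trans n2.
Qed.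

(** The orthogonal complement of the range of S + sigma is the kernel of
    S^* - sigma, because conj sigma = - sigma. *)
Lemma perp_ran_adjoint S sigma h : symmetric_on S -> imag_unit sigma ->
  perp_ran (translate S sigma) h <-> adjoint S (h, sigma *: h).
Proof.
move=> sS su; split.
- move=> [hh ph]; have hsh := HZ sigma hh; split=> //; split=> // x Dx /=.
  have hx := DH Dx; have hSx := sS.1.1 _ Dx; have hsx := HZ sigma hx.
  have := ph _ Dx; rewrite /translate (dotDl hilb)// dot_unitN// => /subr0_eq.
  by [].
- move=> [hh [hsh ah]]; rewrite /= in hh hsh ah; split=> // x Dx.
  have hx := DH Dx; have hSx := sS.1.1 _ Dx; have hsx := HZ sigma hx.
  by rewrite /translate (dotDl hilb)// ah// dot_unitN// subrr.
Qed.

(** A vector of the complement is an eigenvector of S^* for the eigenvalue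
    sigma; if S^* is the closure of S, [graph_closure_le] leaves only 0. *)
Lemma selfadjoint_perp S sigma h : symmetric_on S -> imag_unit sigma ->
  adjoint S `<=` graph_closure S -> perp_ran (translate S sigma) h -> h = 0.
Proof.
move=> sS su aS ph; have hh := ph.1.
have c := aS _ ((perp_ran_adjoint _ sS su).1 ph).
have [n1 _] := graph_closure_le sS (imag_unitN su) c.
apply: (nrm_eq0 hilb hh); apply/eqP; rewrite eq_le (nrm_ge0) andbT.
by apply: le_trans n1 _; rewrite scaleNr subrr (nrm0 hilb).
Qed.

(** Given (h, h') in the adjoint, surjectivity provides (f, g) in the closure
    with g + i f = h' + i h; then h - f is in the complement of the range of
    S - i, hence h = f. *)
Lemma perp_selfadjoint S : symmetric_on S ->
  (forall sigma h, imag_unit sigma -> perp_ran (translate S sigma) h -> h = 0) ->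
  adjoint S `<=` graph_closure S.
Proof.
move=> sS p0 [h h'] ah; have [hh [hh' ae]] := ah; rewrite /= in hh hh' ae.
have su : imag_unit ('i : R[i]) by left.
have [|f [g [c e]]] := graph_closure_surj sS su (fun h => @p0 _ h su) (u := h' + 'i *: h).
  by apply: HD => //; exact: HZ.
have [hf [hg af]] := graph_closure_adj sS c; rewrite /= in hf hg af.
have e1 : h' - g = - 'i *: (h - f).
  rewrite scaleNr -scalerN opprB scalerBr.
  by apply/eqP; rewrite subr_eq addrAC -subr_eq opprK addrC -e addrC.
have ph : perp_ran (translate S (- 'i)) (h - f).
  apply/(perp_ran_adjoint _ sS (imag_unitN su)); rewrite -e1; split; first exact: (hilB hilb).
  split; first exact: (hilB hilb).
  move=> x Dx /=; have hx := DH Dx; have hSx := sS.1.1 _ Dx.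
  by rewrite !(dotBr hilb)// ae// af.
have /subr0_eq hf0 := p0 _ _ (imag_unitN su) ph.
move: e1; rewrite hf0 subrr scaler0 => /subr0_eq ->.
exact: c.
Qed.

Lemma trivial_no_lin_indep (P : set V) : (forall h, P h -> h = 0) <-> ~ has_lin_indep P 1.
Proof.
split.
- move=> P0 [v [Pv iv]]; have := iv (fun=> 1).
  rewrite big_ord1 (P0 _ (Pv _)) scaler0 => /(_ erefl ord0)/eqP.
  by rewrite oner_eq0.
- move=> nl h Ph; apply: contrapT => h0; apply: nl.
  exists (fun=> h); split=> // c; rewrite big_ord1 => /eqP.
  by rewrite scaler_eq0 => /orP[/eqP c0 i|/eqP//]; rewrite ord1.
Qed.

End SymmetricOperators.

Arguments symmetric_on {R V} H dot D S.
Arguments graph_closure {R V} H dot D S _.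
Arguments adjoint {R V} H dot D S _.

(** * Column vectors *)

Section ColumnVectors.
Context {R : realType} {p : nat}.
Local Notation V := 'cV[R[i]]_p.
Implicit Types (u v w : V) (t : R) (c : R[i]).

Definition vrdot u v : R := complex.Re (vdot u v).

Lemma vrdotE u v : vrdot u v =
  \sum_i (complex.Re (u i 0) * complex.Re (v i 0) +
          complex.Im (u i 0) * complex.Im (v i 0)).
Proof.
have Re_sum (F : 'I_p -> R[i]) :
    complex.Re (\sum_i F i) = \sum_i complex.Re (F i).
  by apply: (big_morph (@complex.Re R)) => [[? ?] [? ?]|].
rewrite /vrdot /vdot mxE Re_sum; apply: eq_bigr => j _.
rewrite !mxE.
case: (u j 0) (v j 0) => [a b] [c d] /=; ring.
Qed.

Lemma vrdotC u v : vrdot u v = vrdot v u.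
Proof. by rewrite !vrdotE; apply: eq_bigr => i _; ring. Qed.

Lemma vrdotDl u v w : vrdot (u + v) w = vrdot u w + vrdot v w.
Proof.
rewrite !vrdotE -big_split; apply: eq_bigr => i _; rewrite !mxE /=.
by case: (u i 0) (v i 0) => [a b] [c d] /=; ring.
Qed.

Lemma vrdotZl t u v : vrdot (t%:C *: u) v = t * vrdot u v.
Proof.
rewrite !vrdotE mulr_sumr; apply: eq_bigr => i _; rewrite !mxE /=.
by case: (u i 0) => [a b] /=; ring.
Qed.

Lemma vrdotNl u v : vrdot (- u) v = - vrdot u v.
Proof.
by rewrite -scaleN1r -(rmorphN1 (real_complex R)) vrdotZl mulN1r.
Qed.

Lemma vrdot_iN u v : vrdot ('i *: u) v = - vrdot u ('i *: v).
Proof.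
rewrite !vrdotE -sumrN; apply: eq_bigr => i _; rewrite !mxE /=.
by case: (u i 0) (v i 0) => [a b] [c d] /=; ring.
Qed.

Lemma Im_vdot u v : complex.Im (vdot u v) = vrdot (- 'i *: u) v.
Proof.
rewrite /vrdot /vdot -scalemxAr [X in complex.Re X]mxE.
by case: ((_ *m _) 0 0) => a b /=; ring.
Qed.

Lemma vrdot_mulmxl (M : 'M[R[i]]_p) u v : vrdot (M *m u) v = vrdot u (M ^t* *m v).
Proof.
by rewrite /vrdot /vdot mulmxA trmx_mul map_mxM trmxCK.
Qed.

Lemma vrdot0l v : vrdot 0 v = 0.
Proof. by rewrite -(scale0r 0) vrdotZl mul0r. Qed.

Lemma vrdot_ge0 u : 0 <= vrdot u u.
Proof. by rewrite vrdotE sumr_ge0// => i _; rewrite addr_ge0// -expr2 sqr_ge0. Qed.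

Lemma vrdot_ge_coord u i :
  complex.Re (u i 0) ^+ 2 + complex.Im (u i 0) ^+ 2 <= vrdot u u.
Proof.
rewrite vrdotE (bigD1 i)//= -!expr2 lerDl sumr_ge0// => j _.
by rewrite addr_ge0// -expr2 sqr_ge0.
Qed.

Lemma vnormE u : vnorm u = Num.sqrt (vrdot u u). Proof. by []. Qed.

Lemma vnorm_ge0 u : 0 <= vnorm u. Proof. exact: sqrtr_ge0. Qed.

Lemma vnorm_sqr u : vnorm u ^+ 2 = vrdot u u.
Proof. by rewrite sqr_sqrtr// vrdot_ge0. Qed.

Lemma vnorm_eq0 u : vnorm u = 0 -> u = 0.
Proof.
move=> u0; have := vnorm_sqr u; rewrite u0 expr0n /= => h.
apply/matrixP => i j; rewrite ord1 mxE.
have := vrdot_ge_coord u i; rewrite -h => h2.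
apply/eqP; rewrite eq_complex /= -[X in X && _]sqrf_eq0 -[X in _ && X]sqrf_eq0.
rewrite -paddr_eq0 ?sqr_ge0//.
by rewrite eq_le h2 addr_ge0 ?sqr_ge0.
Qed.

Lemma vnormZ t u : 0 <= t -> vnorm (t%:C *: u) = t * vnorm u.
Proof.
move=> t0; rewrite vnormE vrdotZl vrdotC vrdotZl mulrA -expr2 sqrtrM ?sqr_ge0//.
by rewrite sqrtr_sqr ger0_norm.
Qed.

Lemma vnormN u : vnorm (- u) = vnorm u.
Proof. by rewrite !vnormE vrdotNl vrdotC vrdotNl opprK. Qed.

Lemma vrdot_quadratic u v t :
  0 <= vrdot u u + 2 * t * vrdot u v + t ^+ 2 * vrdot v v.
Proof.
have := vrdot_ge0 (u + t%:C *: v).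
rewrite vrdotDl ![vrdot _ (u + _)]vrdotC !vrdotDl !vrdotZl ![vrdot _ (_ *: _)]vrdotC !vrdotZl.
rewrite [vrdot v u]vrdotC; move: (vrdot u u) (vrdot u v) (vrdot v v) => a b c.
suff -> : a + 2 * t * b + t ^+ 2 * c = a + t * b + (t * b + t * (t * c)) by [].
by ring.
Qed.

Lemma vnormD u v : vnorm (u + v) <= vnorm u + vnorm v.
Proof.
have := cauchy_schwarz (vrdot_quadratic u v) (vrdot_ge0 _) (vrdot_ge0 _).
rewrite -!vnormE => /(le_trans (ler_norm _)) h.
rewrite -ler_sqr ?nnegrE ?addr_ge0 ?vnorm_ge0//.
rewrite sqrrD !vnorm_sqr vrdotDl ![vrdot _ (u + _)]vrdotC !vrdotDl [vrdot v u]vrdotC.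
move: h; move: (vrdot u u) (vrdot u v) (vrdot v v) (vnorm u * vnorm v) => a b c d; lra.
Qed.

Lemma vnorm0 : vnorm (0 : V) = 0.
Proof. by rewrite vnormE vrdot0l sqrtr0. Qed.

Lemma vnorm_sum (I : finType) (F : I -> V) :
  vnorm (\sum_i F i) <= \sum_i vnorm (F i).
Proof.
elim/big_rec2: _ => [|i x y _ h]; first by rewrite vnorm0.
by apply: le_trans (vnormD _ _) _; rewrite lerD2l.
Qed.

Lemma vrdot_i2 u v : vrdot ('i *: u) ('i *: v) = vrdot u v.
Proof. by rewrite vrdot_iN scalerA -expr2 sqr_i scaleN1r vrdotC vrdotNl opprK vrdotC. Qed.

Lemma vnorm_i u : vnorm ('i *: u) = vnorm u.
Proof. by rewrite !vnormE vrdot_i2. Qed.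

Lemma vnormRZ t u : vnorm (t%:C *: u) = `|t| * vnorm u.
Proof.
by rewrite vnormE vrdotZl vrdotC vrdotZl mulrA -expr2 sqrtrM ?sqr_ge0// sqrtr_sqr.
Qed.

Lemma vnormCZ c u :
  vnorm (c *: u) <= (`|complex.Re c| + `|complex.Im c|) * vnorm u.
Proof.
rewrite {1}(complexE c) scalerDl mulrDl.
by apply: le_trans (vnormD _ _) _; rewrite -scalerA vnorm_i !vnormRZ.
Qed.

(** Makes the set in the definition of the operator norm bounded, so that its
    supremum is meaningful. *)
Lemma mulmx_bounded (M : 'M[R[i]]_p) :
  exists2 K, 0 <= K & forall v, vnorm (M *m v) <= K * vnorm v.
Proof.
(* The factor 2 bounds |Re| + |Im| of an entry by its modulus. *)
exists (2 * \sum_j vnorm (col j M)).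
  by rewrite mulr_ge0// sumr_ge0// => j _; exact: vnorm_ge0.
move=> v.
have -> : M *m v = \sum_j v j 0 *: col j M.
  apply/matrixP => i k; rewrite ord1 summxE mxE; apply: eq_bigr => j _.
  by rewrite !mxE mulrC.
apply: le_trans (vnorm_sum _) _; rewrite mulrAC mulr_sumr ler_sum// => j _.
apply: le_trans (vnormCZ _ _) _; rewrite ler_wpM2r ?vnorm_ge0//.
have h : forall x, x ^+ 2 <= vrdot v v -> `|x| <= vnorm v.
  by move=> x hx; rewrite -sqrtr_sqr ler_wsqrtr.
have := vrdot_ge_coord v j; have := sqr_ge0 (complex.Re (v j 0)).
have := sqr_ge0 (complex.Im (v j 0)) => h1 h2 h3.
have := h (complex.Re (v j 0)); have := h (complex.Im (v j 0)).
lra.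
Qed.

Lemma opnorm_ub (M : 'M[R[i]]_p) :
  has_sup [set vnorm (M *m v) | v in [set v | vnorm v <= 1]].
Proof.
split; first by exists (vnorm (M *m 0)), 0 => //=; rewrite vnorm0.
have [K K0 HK] := mulmx_bounded M; exists K => _ [v /= v1 <-].
by apply: le_trans (HK v) _; rewrite ler_piMr.
Qed.

Lemma opnorm_ge0 (M : 'M[R[i]]_p) : 0 <= opnorm M.
Proof.
apply: le_trans (vnorm_ge0 (M *m 0)) _; apply: ub_le_sup.
  by case: (opnorm_ub M).
by exists 0 => //=; rewrite vnorm0.
Qed.

Lemma vnorm_mulmx (M : 'M[R[i]]_p) v : vnorm (M *m v) <= opnorm M * vnorm v.
Proof.
have [v0|v0] := eqVneq (vnorm v) 0.
  by rewrite v0 (vnorm_eq0 v0) mulmx0 vnorm0 mulr0.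
have v1 : 0 < vnorm v by rewrite lt_neqAle eq_sym v0 vnorm_ge0.
rewrite -ler_pdivrMr// mulrC -vnormZ ?invr_ge0 ?vnorm_ge0// scalemxAr.
apply: ub_le_sup; first by case: (opnorm_ub M).
by exists (((vnorm v)^-1)%:C *: v) => //=; rewrite vnormZ ?invr_ge0 ?vnorm_ge0// mulVf.
Qed.
End ColumnVectors.

(** * Square-summable sequences *)

Section SquareSummable.
Context {R : realType} {p : nat}.
Local Notation E := (vecseq R p).
Implicit Types (f g h : E) (t : R) (c : R[i]).

Definition rdot f g : R := limn (series (fun n => vrdot (f n) (g n))).

Lemma series_nd f : {homo series (fun n => vrdot (f n) (f n)) : n m / (n <= m)%N >-> n <= m}.
Proof. by apply: nondecreasing_series => n _ _; exact: vrdot_ge0. Qed.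

Lemma l2P f : l2 f <-> cvgn (series (fun n => vrdot (f n) (f n))).
Proof.
rewrite /l2 /l2normsq /=; under eq_eseriesr do rewrite vnorm_sqr.
split=> h.
  by apply: nnseries_is_cvg => // n; exact: vrdot_ge0.
have -> : (\sum_(0 <= n <oo) (vrdot (f n) (f n))%:E)%E =
  (limn (series (fun n => vrdot (f n) (f n))))%:E; last exact: ltry.
rewrite -EFin_lim//; congr (limn _); apply/funext => n /=.
by rewrite /series /= sumEFin.
Qed.

Lemma l2normsqE f : l2 f -> l2normsq f = (rdot f f)%:E.
Proof.
move=> /l2P h; rewrite /l2normsq; under eq_eseriesr do rewrite vnorm_sqr.
rewrite /rdot -EFin_lim//; congr (limn _); apply/funext => n /=.
by rewrite /series /= sumEFin.
Qed.

Lemma psum_le_rdot f n : l2 f -> series (fun n => vrdot (f n) (f n)) n <= rdot f f.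
Proof. by move=> /l2P h; apply: nondecreasing_cvgn_le => //; exact: series_nd. Qed.

Lemma psum_bound f M : (forall n, series (fun n => vrdot (f n) (f n)) n <= M) ->
  l2 f /\ rdot f f <= M.
Proof.
move=> h; have cv : cvgn (series (fun n => vrdot (f n) (f n))).
  by apply: nondecreasing_is_cvgn; [exact: series_nd|exists M => _ [n _ <-]].
by split; [apply/l2P|apply: limr_le => //; near=> n].
Unshelve. all: by end_near. Qed.

Lemma rdot_ge0 f : 0 <= rdot f f.
Proof.
have [h|h] := pselect (l2 f).
  by apply: le_trans (psum_le_rdot 0 h); rewrite /series /= big_geq.
rewrite /rdot dvgP//; by move/l2P: h.
Qed.

Lemma vrdot_le_rdot f n : l2 f -> vrdot (f n) (f n) <= rdot f f.
Proof.
move=> h; apply: le_trans (psum_le_rdot n.+1 h).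
by rewrite seriesSr /= lerDr; apply: sumr_ge0 => i _; exact: vrdot_ge0.
Qed.

Lemma rdot_cvg f g : l2 f -> l2 g -> cvgn (series (fun n => vrdot (f n) (g n))).
Proof.
move=> /l2P hf /l2P hg; apply: normed_cvg.
apply: (series_le_cvg _ _ _ (is_cvg_seriesD hf hg)) => n //=.
  by rewrite addr_ge0// vrdot_ge0.
rewrite -[leRHS]/(vrdot (f n) (f n) + vrdot (g n) (g n)).
have := vrdot_quadratic (f n) (g n) 1; have := vrdot_quadratic (f n) (g n) (-1).
have := vrdot_ge0 (f n); have := vrdot_ge0 (g n).
move: (vrdot (f n) (f n)) (vrdot (f n) (g n)) (vrdot (g n) (g n)) => a b c *.
by rewrite ler_norml; apply/andP; split; lra.
Qed.

Lemma rdotC f g : rdot f g = rdot g f.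
Proof. by rewrite /rdot; under eq_fun do rewrite vrdotC. Qed.

Lemma rdotDl f g h : l2 f -> l2 g -> l2 h ->
  rdot (f + g) h = rdot f h + rdot g h.
Proof.
move=> hf hg hh; rewrite /rdot -lim_seriesD; [|exact: rdot_cvg..].
by congr (limn (series _)); apply/funext => n; rewrite vrdotDl.
Qed.

Lemma rdotZl t f g : l2 f -> l2 g -> rdot (t%:C *: f) g = t * rdot f g.
Proof.
move=> hf hg; rewrite /rdot -[RHS]/(t *: _) -lim_seriesZ; last exact: rdot_cvg.
by congr (limn (series _)); apply/funext => n; rewrite vrdotZl.
Qed.

Lemma rdot_i2 f g : rdot ('i *: f) ('i *: g) = rdot f g.
Proof. by rewrite /rdot; under eq_fun do rewrite vrdot_i2. Qed.

Lemma l2dotE f g : l2dot f g = rdot f g +i* rdot (- 'i *: f) g.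
Proof.
by rewrite /l2dot /rdot; congr (_ +i* _); under eq_fun do rewrite Im_vdot.
Qed.

Lemma Re_l2dot f g : complex.Re (l2dot f g) = rdot f g.
Proof. by rewrite l2dotE. Qed.

Lemma l2_0 : l2 (0 : E).
Proof.
by apply: (proj1 (@psum_bound 0 0 _)) => n; rewrite /series /= big1// => k _; rewrite vrdot0l.
Qed.

Lemma l2D f g : l2 f -> l2 g -> l2 (f + g).
Proof.
move=> hf hg; apply: (proj1 (@psum_bound _ (2 * rdot f f + 2 * rdot g g) _)) => n.
have := psum_le_rdot n hf; have := psum_le_rdot n hg => h1 h2.
apply: (@le_trans _ _ (2 * series (fun n => vrdot (f n) (f n)) n +
  2 * series (fun n => vrdot (g n) (g n)) n)); last lra.
rewrite /series /= !mulr_sumr -big_split; apply: ler_sum => k _ /=.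
have := vrdot_quadratic (f k) (g k) (-1).
rewrite vrdotDl ![vrdot _ (f k + _)]vrdotC !vrdotDl [vrdot (g k) (f k)]vrdotC.
move: (vrdot (f k) (f k)) (vrdot (f k) (g k)) (vrdot (g k) (g k)) => a b c; lra.
Qed.

Lemma l2RZ t f : l2 f -> l2 (t%:C *: f).
Proof.
move=> hf; apply: (proj1 (@psum_bound _ (t ^+ 2 * rdot f f) _)) => n.
apply: le_trans (ler_wpM2l (sqr_ge0 t) (psum_le_rdot n hf)).
rewrite /series /= !mulr_sumr; apply: ler_sum => k _ /=.
by rewrite vrdotZl vrdotC vrdotZl mulrA expr2.
Qed.

Lemma l2i f : l2 f -> l2 ('i *: f).
Proof.
move=> hf; apply: (proj1 (@psum_bound _ (rdot f f) _)) => n.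
apply: le_trans (psum_le_rdot n hf).
by rewrite /series /=; apply: ler_sum => k _ /=; rewrite vrdot_i2.
Qed.

Lemma l2Z c f : l2 f -> l2 (c *: f).
Proof.
move=> hf; rewrite (complexE c) scalerDl -scalerA.
by apply: l2D; [|apply: l2i]; apply: l2RZ.
Qed.

Lemma vnorm_le_nrm f n : l2 f -> vnorm (f n) <= nrm rdot f.
Proof. by move=> h; apply: ler_wsqrtr; exact: vrdot_le_rdot. Qed.

Lemma l2B f g : l2 f -> l2 g -> l2 (f - g).
Proof. by move=> hf hg; apply: l2D => //; rewrite -scaleN1r; apply: l2Z. Qed.

Lemma real_cauchy_cvg (x : nat -> R) :
  (forall e : R, 0 < e -> exists k0, forall m k, (k0 <= m)%N -> (k0 <= k)%N ->
    `|x m - x k| <= e) -> cvgn x.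
Proof.
move=> h; apply: cauchy_cvg; apply: cauchy_exP => e e0.
have [k0 hk] := h (e / 2) (divr_gt0 e0 (ltr0Sn R 1)).
exists (x k0), k0 => // k /= kk; rewrite /ball /=.
by apply: le_lt_trans (hk _ _ (leqnn _) kk) _; rewrite ltr_pdivrMr ?ltr_pMr// ltr1n.
Qed.

Lemma vrdot_sub_cvg (w : nat -> 'cV[R[i]]_p) (v z : 'cV[R[i]]_p) :
  (forall i, complex.Re (w j i 0) @[j --> \oo] --> complex.Re (v i 0)) ->
  (forall i, complex.Im (w j i 0) @[j --> \oo] --> complex.Im (v i 0)) ->
  vrdot (z - w j) (z - w j) @[j --> \oo] --> vrdot (z - v) (z - v).
Proof.
move=> hRe hIm; rewrite vrdotE; under eq_fun do rewrite vrdotE.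
apply: (@cvg_big _ _ _ _ _ (@add_continuous _)) => i _.
rewrite !mxE.
have e1 x : complex.Re (z i 0 - x) = complex.Re (z i 0) - complex.Re x.
  by case: (z i 0) x => [? ?] [? ?].
have e2 x : complex.Im (z i 0 - x) = complex.Im (z i 0) - complex.Im x.
  by case: (z i 0) x => [? ?] [? ?].
under eq_fun do rewrite !mxE e1 e2; rewrite e1 e2.
by apply: cvgD; apply: cvgM; apply: cvgB => //; apply: cvg_cst.
Qed.

(** The limit is taken coordinatewise; the bound on the partial sums of
    |u k - u j|^2 survives the limit in j, one partial sum at a time. *)
Lemma l2_complete (u : nat -> E) : (forall k, l2 (u k)) ->
  (forall e : R, 0 < e -> exists k0, forall m k, (k0 <= m)%N -> (k0 <= k)%N ->
    nrm rdot (u m - u k) <= e) ->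
  exists2 f, l2 f &
    forall e : R, 0 < e -> exists k0, forall k, (k0 <= k)%N -> nrm rdot (u k - f) <= e.
Proof.
move=> hu hc.
have coord (m k n : nat) i :
    `|complex.Re (u m n i 0) - complex.Re (u k n i 0)| <= nrm rdot (u m - u k) /\
    `|complex.Im (u m n i 0) - complex.Im (u k n i 0)| <= nrm rdot (u m - u k).
  have := vnorm_le_nrm n (l2B (hu m) (hu k)).
  have := vrdot_ge_coord ((u m - u k) n) i; rewrite /GRing.add/= !mxE.
  case: (u m n i 0) (u k n i 0) => [a b] [a' b'] /= h1 h2.
  have h : forall x, x ^+ 2 <= (a - a') ^+ 2 + (b - b') ^+ 2 -> `|x| <= nrm rdot (u m - u k).
    move=> x hx; apply: le_trans h2; rewrite -sqrtr_sqr ler_wsqrtr//.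
    exact: le_trans h1.
  by split; apply: h; rewrite ?lerDl ?lerDr sqr_ge0.
have cRe n i : cvgn (fun k => complex.Re (u k n i 0)).
  apply: real_cauchy_cvg => e /hc[k0 hk]; exists k0 => m k hm hk'.
  by apply: le_trans (hk m k hm hk'); case: (coord m k n i).
have cIm n i : cvgn (fun k => complex.Im (u k n i 0)).
  apply: real_cauchy_cvg => e /hc[k0 hk]; exists k0 => m k hm hk'.
  by apply: le_trans (hk m k hm hk'); case: (coord m k n i).
pose f : E := fun n => \col_i (limn (fun k => complex.Re (u k n i 0)) +i*
                               limn (fun k => complex.Im (u k n i 0))).
have key e k0 : 0 < e -> (forall m k, (k0 <= m)%N -> (k0 <= k)%N ->
    nrm rdot (u m - u k) <= e) -> forall k, (k0 <= k)%N -> l2 (u k - f) /\ nrm rdot (u k - f) <= e.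
  move=> e0 hk0 k kk.
  have [] := @psum_bound (u k - f) (e ^+ 2).
    move=> m.
    have cv : series (fun n => vrdot ((u k - u j) n) ((u k - u j) n)) m @[j --> \oo] -->
              series (fun n => vrdot ((u k - f) n) ((u k - f) n)) m.
      apply: (@cvg_big _ _ _ _ _ (@add_continuous _)) => n _.
      by apply: vrdot_sub_cvg => i; rewrite mxE /=; [exact: cRe|exact: cIm].
    rewrite -(cvg_lim (@Rhausdorff R) cv); apply: limr_le.
      by apply/cvg_ex; eexists; exact: cv.
    exists k0 => // j /= jk.
    apply: le_trans (psum_le_rdot _ (l2B (hu _) (hu _))) _.
    rewrite -[leLHS](sqr_sqrtr (rdot_ge0 _)).
    by rewrite ler_sqr ?nnegrE ?sqrtr_ge0 ?hk0// ltW.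
  move=> h1 h2; split=> //.
  by rewrite -(ger0_norm (ltW e0)) -sqrtr_sqr ler_wsqrtr.
have hf : l2 f.
  have [k0 hk0] := hc 1 ltr01.
  have [h _] := key 1 k0 ltr01 hk0 k0 (leqnn _).
  by rewrite -(subKr (u k0) f); apply: l2B.
exists f => // e e0; have [k0 hk0] := hc e e0; exists k0 => k kk.
by case: (key e k0 e0 hk0 k kk).
Qed.

Lemma l2_hilbert : hilbert (@l2 R p) rdot.
Proof.
split.
- exact: l2_0.
- exact: l2D.
- exact: l2Z.
- exact: rdotC.
- exact: rdotDl.
- exact: rdotZl.
- exact: rdot_i2.
- by move=> f _; exact: rdot_ge0.
- move=> f hf f0; apply/funext => n; apply: vnorm_eq0.
  apply/eqP; rewrite eq_le vnorm_ge0 andbT.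
  by have := vnorm_le_nrm n hf; rewrite /nrm f0 sqrtr0.
- exact: l2_complete.
Qed.

Lemma nrm_dom f (g : E) K : 0 <= K -> l2 f ->
  (forall n, vnorm (g n) <= K * vnorm (f n)) -> l2 g /\ nrm rdot g <= K * nrm rdot f.
Proof.
move=> K0 hf h.
have [] := @psum_bound g (K ^+ 2 * rdot f f).
  move=> n; apply: le_trans (ler_wpM2l (sqr_ge0 K) (psum_le_rdot n hf)).
  rewrite /series /= !mulr_sumr; apply: ler_sum => k _ /=.
  by rewrite -!vnorm_sqr -exprMn ler_sqr ?nnegrE ?mulr_ge0 ?vnorm_ge0.
move=> hg le; split => //.
by rewrite /nrm -(ger0_norm K0) -sqrtr_sqr -sqrtrM ?sqr_ge0// ler_wsqrtr.
Qed.

Lemma nrm_shift f : l2 f -> l2 (fun n => f n.+1) /\ nrm rdot (fun n => f n.+1) <= nrm rdot f.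
Proof.
move=> hf; have [] := @psum_bound (fun n => f n.+1) (rdot f f).
  move=> n; apply: le_trans (psum_le_rdot n.+1 hf).
  by rewrite /series /= big_nat_recl//= lerDr vrdot_ge0.
by move=> h1 h2; split; [exact: h1|exact: ler_wsqrtr h2].
Qed.

Lemma finsupp_l2 f : finsupp f -> l2 f.
Proof.
move=> [m hm]; apply: (proj1 (@psum_bound f (series (fun n => vrdot (f n) (f n)) m) _)) => n.
have [/series_nd//|/ltnW h] := leqP n m.
rewrite /series /= [leLHS](big_cat_nat (n := m))//=.
suff -> : \sum_(m <= i < n) vrdot (f i) (f i) = 0 by rewrite addr0.
rewrite big_nat_cond big1// => k.
by rewrite andbT => /andP[/hm -> _]; rewrite vrdot0l.
Qed.

End SquareSummable.

(** * Jacobi maps *)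

Section JacobiMaps.
Context {R : realType} {p : nat}.
Local Notation E := (vecseq R p).
Local Notation M := 'M[R[i]]_p.
Implicit Types (f g : E) (A B : nat -> M).

Lemma finsupp0 : finsupp (0 : E).
Proof. by exists 0%N. Qed.

Lemma finsuppD f g : finsupp f -> finsupp g -> finsupp (f + g).
Proof.
move=> [m hm] [k hk]; exists (maxn m k) => n; rewrite geq_max => /andP[h1 h2].
by rewrite -[LHS]/(f n + g n) hm// hk// addr0.
Qed.

Lemma finsuppZ c f : finsupp f -> finsupp (c *: f).
Proof.
by move=> [m hm]; exists m => n mn; rewrite -[LHS]/(c *: f n) hm// scaler0.
Qed.

Lemma rdot_finsupp f g m : (forall n, (m <= n)%N -> f n = 0) ->
  rdot f g = \sum_(0 <= k < m) vrdot (f k) (g k).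
Proof.
move=> hm; apply: cvg_lim; first exact: Rhausdorff.
apply: cvg_near_cst; exists m => // n /= mn; apply/eqP.
rewrite /series /= (big_cat_nat (n := m))//=.
suff -> : \sum_(m <= i < n) vrdot (f i) (g i) = 0 by rewrite addr0.
rewrite big_nat_cond big1// => k.
by rewrite andbT => /andP[/hm -> _]; rewrite vrdot0l.
Qed.

Lemma jacobi_finsupp A B f : finsupp f -> finsupp (jacobi_map A B f).
Proof.
move=> [m hm]; exists m.+1 => -[//|n] mn; rewrite /jacobi_map.
by rewrite !(hm _ (leqW (leqW mn)), hm _ (leqW mn), hm _ mn) !mulmx0 !addr0.
Qed.

Lemma jacobi_add A B f g :
  jacobi_map A B (f + g) = jacobi_map A B f + jacobi_map A B g.
Proof.
apply/funext => n; rewrite -[RHS]/(jacobi_map A B f n + jacobi_map A B g n) /jacobi_map.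
have fgE k : (f + g) k = f k + g k by [].
case: n => [|n]; rewrite !fgE !mulmxDr ?add0r; last rewrite [X in _ = X]addrACA.
  by rewrite addrACA.
by rewrite [X in _ = X + _]addrACA.
Qed.

Lemma jacobi_scale A B c f : jacobi_map A B (c *: f) = c *: jacobi_map A B f.
Proof.
apply/funext => n; rewrite -[RHS]/(c *: jacobi_map A B f n) /jacobi_map.
have fE k : (c *: f) k = c *: f k by [].
by case: n => [|n]; rewrite !fE -!scalemxAr !scalerDr ?scaler0.
Qed.

Lemma jacobi_linear A B : linear_on l2 finsupp (jacobi_map A B).
Proof.
split; [|split].
- by move=> f /(jacobi_finsupp A B)/finsupp_l2.
- by move=> f g _ _; exact: jacobi_add.
- by move=> c f _; exact: jacobi_scale.
Qed.

(** Green's formula: the off-diagonal terms telescope and only the boundary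
    term at m survives. *)
Lemma jacobi_green A B f g m : (forall n, A n = (A n) ^t*) ->
  \sum_(0 <= k < m.+1) vrdot (jacobi_map A B f k) (g k) =
  \sum_(0 <= k < m.+1) vrdot (f k) (jacobi_map A B g k) +
  (vrdot (B m *m f m.+1) (g m) - vrdot (f m) (B m *m g m.+1)).
Proof.
move=> Ah; have Asym n u v : vrdot (A n *m u) v = vrdot u (A n *m v).
  by rewrite vrdot_mulmxl -Ah.
have Bsym n u v : vrdot ((B n) ^t* *m u) v = vrdot u (B n *m v).
  by rewrite vrdot_mulmxl trmxCK.
elim: m => [|m IH].
  rewrite !big_nat1 /jacobi_map !add0r [vrdot (f 0%N) _]vrdotC !vrdotDl Asym.
  rewrite ![vrdot (_ *m g _) _]vrdotC.
  by move: (vrdot _ _) (vrdot _ _) (vrdot _ _) => a b c; ring.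
have step (F : nat -> R) :
    \sum_(0 <= k < m.+2) F k = \sum_(0 <= k < m.+1) F k + F m.+1.
  by rewrite big_nat_recr.
rewrite !step IH -!addrA; congr (_ + _).
rewrite /jacobi_map [vrdot (f m.+1) (_ + _ + _)]vrdotC !vrdotDl Asym !Bsym.
rewrite [vrdot (A m.+1 *m g _) _]vrdotC [vrdot (B m.+1 *m g _) _]vrdotC [vrdot (g m) _]vrdotC.
move: (vrdot (f m.+1) _) (vrdot (f m.+1) _) (vrdot (f m) _) (vrdot (B m *m _) _)
  (vrdot (B m.+1 *m _) _).
move => *.
ring.
Qed.

Lemma jacobi_symmetric A B : (forall n, A n = (A n) ^t*) ->
  symmetric_on l2 rdot finsupp (jacobi_map A B).
Proof.
move=> Ah; split; first exact: jacobi_linear.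
move=> f g [m hm] _; rewrite (@rdot_finsupp _ _ m.+1); last first.
  move=> -[//|n] mn; rewrite /jacobi_map.
  by rewrite !(hm _ (leqW (leqW mn)), hm _ (leqW mn), hm _ mn) !mulmx0 !addr0.
rewrite (@rdot_finsupp _ _ m.+1); last by move=> n mn; apply: hm; exact: ltnW.
by rewrite jacobi_green// !hm// mulmx0 !vrdot0l subrr addr0.
Qed.

End JacobiMaps.

(** * The relative bound *)

Section RelativeBound.
Context {R : realType} {p : nat}.
Local Notation E := (vecseq R p).
Local Notation "'N'" := (nrm rdot).
Implicit Types (f g : E).

Lemma nneseries_partial_le (a : nat -> R) (m : nat) (K : R) :
  (forall n, 0 <= a n) -> (\sum_(m <= n <oo) (a n)%:E <= K%:E)%E ->
  forall n, \sum_(m <= k < n) a k <= K.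
Proof.
move=> a0 h n; rewrite -lee_fin; apply: le_trans h.
rewrite -sumEFin; apply: nneseries_lim_ge => k _ _.
by rewrite lee_fin.
Qed.

Lemma sqrt_form_le (s r x y z : R) : 0 <= s -> 0 <= r -> 0 <= x -> 0 <= y -> 0 <= z ->
  z ^+ 2 <= s ^+ 2 * x ^+ 2 + r ^+ 2 * y ^+ 2 -> z <= s * x + r * y.
Proof.
move=> s0 r0 x0 y0 z0 h; have sx : 0 <= s * x by rewrite mulr_ge0.
have ry : 0 <= r * y by rewrite mulr_ge0.
rewrite -ler_sqr ?nnegrE ?addr_ge0//; apply: le_trans h _.
by rewrite sqrrD -!exprMn lerD2r lerDl mulrn_wge0// mulr_ge0.
Qed.

Lemma local_bound (A B : nat -> 'M[R[i]]_p) n :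
  exists2 K, 0 <= K & forall f, l2 f -> vnorm (jacobi_map A B f n) <= K * N f.
Proof.
have aux (M : 'M[R[i]]_p) k : exists2 K, 0 <= K &
    forall f, l2 f -> vnorm (M *m f k) <= K * N f.
  have [K K0 hK] := mulmx_bounded M; exists K => // f hf.
  by apply: le_trans (hK _) _; apply: ler_wpM2l => //; exact: vnorm_le_nrm.
have [K1 K10 h1] := aux (A n) n; have [K2 K20 h2] := aux (B n) n.+1.
case: n K1 K10 h1 K2 K20 h2 => [|n] K1 K10 h1 K2 K20 h2.
  exists (K1 + K2); first exact: addr_ge0.
  move=> f hf; rewrite /jacobi_map add0r mulrDl; apply: le_trans (vnormD _ _) _.
  by apply: lerD; [exact: h1|exact: h2].
have [K3 K30 h3] := aux ((B n) ^t*) n.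
exists (K3 + K1 + K2); first by rewrite !addr_ge0.
move=> f hf; rewrite /jacobi_map !mulrDl; apply: le_trans (vnormD _ _) _.
apply: lerD; last exact: h2.
by apply: le_trans (vnormD _ _) _; apply: lerD; [exact: h3|exact: h1].
Qed.

(** Finitely many rows form a bounded operator; this disposes of the rows on
    which the hypotheses say nothing. *)
Lemma truncation_bound (A B : nat -> 'M[R[i]]_p) M :
  exists2 K, 0 <= K & forall f, finsupp f ->
    N (fun n => if (n < M)%N then jacobi_map A B f n else 0) <= K * N f.
Proof.
have /choice[K hK] : forall n, exists K, 0 <= K /\
    forall f, l2 f -> vnorm (jacobi_map A B f n) <= K * N f.
  by move=> n; have [K] := local_bound A B n; exists K.
pose L := \sum_(0 <= k < M) K k ^+ 2.
have L0 : 0 <= L by apply: sumr_ge0 => k _; exact: sqr_ge0.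
exists (Num.sqrt L); first exact: sqrtr_ge0.
move=> f ff; have hf := finsupp_l2 ff.
rewrite /nrm -sqrtrM// ler_wsqrtr// (@rdot_finsupp _ _ _ _ M); last first.
  by move=> n; rewrite leqNgt => /negbTE ->.
rewrite mulr_suml; apply: ler_sum => k _ /=.
case: ifP => _; last by rewrite vrdot0l mulr_ge0 ?sqr_ge0// rdot_ge0.
have [K0 /(_ f hf) h] := hK k.
rewrite -(nrm_sqr l2_hilbert hf) -exprMn -vnorm_sqr.
by rewrite ler_sqr ?nnegrE ?vnorm_ge0 ?mulr_ge0 ?nrm_ge0.
Qed.

(** Replaces a supremum in the extended reals by a real bound; the member n0
    rules out the value -oo. *)
Lemma ereal_sup_lt (P : set nat) (F : nat -> R) (c : \bar R) n0 : P n0 ->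
  (forall n, 0 <= F n) ->
  (ereal_sup [set (F n)%:E | n in P] < c)%E ->
  exists a, [/\ 0 <= a, (a%:E < c)%E & forall n, P n -> F n <= a].
Proof.
move=> Pn0 F0 hc; set s := ereal_sup _ in hc.
have ub n : P n -> ((F n)%:E <= s)%E.
  by move=> Pn; apply: ereal_sup_ubound; exists n.
have s0 : (0 <= s)%E by apply: le_trans (ub _ Pn0); rewrite lee_fin.
have sf : s \is a fin_num.
  by rewrite ge0_fin_numE//; apply: lt_le_trans hc _; rewrite leey.
exists (fine s); split; first exact: fine_ge0.
  by rewrite fineK.
by move=> n /ub; rewrite -{1}(fineK sf) lee_fin.
Qed.

Section Entries.
Variables A B hA hB : nat -> 'M[R[i]]_p.
Hypothesis B_unit : forall n, B n \in unitmx.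
Local Notation T n := ((hB n) ^t* *m invmx ((B n) ^t*)).
Local Notation J := (jacobi_map A B).
Local Notation hJ := (jacobi_map hA hB).

(** Multiplying row n + 1 of J by T n reproduces the term hB_n^* f_n, which
    therefore cancels. *)
Lemma jacobi_decomposition f n :
  hJ f n.+1 - J f n.+1 = - ((1%:M - T n) *m J f n.+1) +
    (hA n.+1 - T n *m A n.+1) *m f n.+1 + (hB n.+1 - T n *m B n.+1) *m f n.+2.
Proof.
have Bu : (B n) ^t* \in unitmx by rewrite map_unitmx unitmx_tr.
rewrite /jacobi_map !mulmxBl mul1mx opprB !mulmxDr -!mulmxA mulKmx//.
have cancel (a b c d u v : 'cV[R[i]]_p) :
    a + b + c - d = a + u + v - d + (b - u) + (c - v).
  by apply/matrixP => i j; rewrite !mxE; ring.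
exact: cancel.
Qed.

(** The relative bound of the middle coefficient is arbitrarily small, so it
    can be chosen as half of the gap 1 - a. *)
Lemma relative_bound N0 (a CB : R) :
  0 <= a < 1 -> 0 <= CB ->
  (forall n, (N0 <= n)%N -> opnorm (1%:M - T n) <= a) ->
  (forall n, (N0 <= n.+1)%N -> opnorm (hB n.+1 - T n *m B n.+1) <= CB) ->
  (forall eps : R, 0 < eps -> exists N1 : nat, exists CA : R, (0 < N1)%N /\ 0 < CA /\
     forall f, finsupp f ->
        (\sum_(N1 <= n <oo)
           ((vnorm ((hA n - T n.-1 *m A n) *m f n)) ^+ 2)%:E
         <= eps%:E * l2normsq (J f) + CA%:E * l2normsq f)%E) ->
  exists a' C : R, [/\ 0 <= a' < 1, 0 <= C &
    forall f, finsupp f -> N (hJ f - J f) <= a' * N (J f) + C * N f].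
Proof.
move=> /andP[a0 a1] CB0 hi hii hiii.
pose s := (1 - a) / 2; have s0 : 0 < s by rewrite divr_gt0// subr_gt0.
have [N1 [CA [N10 [CA0 hA1]]]] := hiii (s ^+ 2) (exprn_gt0 2 s0).
pose M := maxn N0.+1 N1.
have [L1 L10 hL1] := truncation_bound hA hB M.
have [L2 L20 hL2] := truncation_bound A B M.
exists (a + s), (Num.sqrt CA + CB + (L1 + L2)); split.
- by rewrite addr_ge0 ?(ltW s0)//= /s; lra.
- by rewrite !addr_ge0 ?sqrtr_ge0.
move=> f ff; have hf := finsupp_l2 ff.
have hJf := finsupp_l2 (jacobi_finsupp A B ff).
pose W1 : E := fun n => if (n < M)%N then hJ f n else 0.
pose W2 : E := fun n => if (n < M)%N then J f n else 0.
(* X, Y, Z are the three terms of the decomposition in the rows n >= M; in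
   these rows n >= 1, so that n.-1 is the true predecessor. *)
pose X : E := fun n => if (n < M)%N then 0 else - ((1%:M - T n.-1) *m J f n).
pose Y : E := fun n => if (n < M)%N then 0 else (hA n - T n.-1 *m A n) *m f n.
pose Z : E := fun n => if (n < M)%N then 0 else (hB n - T n.-1 *m B n) *m f n.+1.
have e : hJ f - J f = (X + Y + Z) + (W1 - W2).
  apply/funext => n.
  rewrite -[LHS]/(hJ f n - J f n) -[RHS]/((X n + Y n + Z n) + (W1 n - W2 n)).
  rewrite /X /Y /Z /W1 /W2; case: ltnP => nM; first by rewrite !add0r.
  rewrite subr0 addr0; case: n nM => [|n] nM; last exact: jacobi_decomposition.
  by move: nM; rewrite /M geq_max ltn0.
have fW (F : E) : (forall n, (M <= n)%N -> F n = 0) -> l2 F.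
  by move=> hF; apply: finsupp_l2; exists M.
have lW1 : l2 W1 by apply: fW => n; rewrite /W1 ltnNge => ->.
have lW2 : l2 W2 by apply: fW => n; rewrite /W2 ltnNge => ->.
have MP n : (n < M)%N = false -> exists2 k, n = k.+1 & (N0 <= k)%N /\ (N1 <= n)%N.
  move=> /negbT; rewrite -leqNgt geq_max => /andP[h1 h2].
  by case: n h1 h2 => // k h1 h2; exists k.
have [lX nX] : l2 X /\ N X <= a * N (J f).
  apply: nrm_dom => // n; rewrite /X; case: ifPn => [_|/negbTE/MP[k -> [kN _]]].
    by rewrite vnorm0 mulr_ge0 ?vnorm_ge0.
  rewrite vnormN; apply: le_trans (vnorm_mulmx _ _) _.
  by apply: ler_wpM2r (vnorm_ge0 _) _ _ (hi _ kN).
have [lS nS] := nrm_shift hf.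
have [lZ nZ] : l2 Z /\ N Z <= CB * N (fun n => f n.+1).
  apply: nrm_dom => // n; rewrite /Z; case: ifPn => [_|/negbTE/MP[k -> [kN _]]].
    by rewrite vnorm0 mulr_ge0 ?vnorm_ge0.
  apply: le_trans (vnorm_mulmx _ _) _.
  by apply: ler_wpM2r (vnorm_ge0 _) _ _ (hii _ (leqW kN)).
have [lY nY] : l2 Y /\ rdot Y Y <= s ^+ 2 * N (J f) ^+ 2 + Num.sqrt CA ^+ 2 * N f ^+ 2.
  have := hA1 _ ff; rewrite (l2normsqE hJf) (l2normsqE hf) -!EFinM -EFinD.
  rewrite (sqr_sqrtr (ltW CA0)) (nrm_sqr l2_hilbert hJf) (nrm_sqr l2_hilbert hf).
  move=> /nneseries_partial_le hs; apply: psum_bound => n.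
  apply: le_trans (hs _ n); last by move=> k; exact: sqr_ge0.
  have [nN|Nn] := leqP n N1.
    rewrite [leRHS]big_geq// /series /= big_nat_cond big1// => k.
    rewrite andbT /Y => /andP[_ kn]; rewrite ifT ?vrdot0l//.
    by rewrite (leq_trans kn)// (leq_trans nN)// leq_maxr.
  rewrite /series /= (big_cat_nat (n := N1)) ?(ltnW Nn)//=.
  rewrite big_nat_cond big1 ?add0r; last first.
    move=> k; rewrite andbT /Y => /andP[_ kn]; rewrite ifT ?vrdot0l//.
    by rewrite (leq_trans kn)// leq_maxr.
  apply: ler_sum => k _; rewrite /Y vnorm_sqr; case: ifP => // _.
  by rewrite vrdot0l vrdot_ge0.
have nY' : N Y <= s * N (J f) + Num.sqrt CA * N f.
  apply: sqrt_form_le; rewrite ?nrm_ge0 ?sqrtr_ge0 ?(ltW s0)//.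
  by rewrite (nrm_sqr l2_hilbert lY).
have n1 := hL1 _ ff; have n2 := hL2 _ ff; rewrite -/W1 in n1; rewrite -/W2 in n2.
have nD := @nrmD _ _ _ _ (@l2_hilbert R p).
have lXY := l2D lX lY; have lXYZ := l2D lXY lZ; have lW := l2B lW1 lW2.
rewrite e; apply: le_trans (nD _ _ lXYZ lW) _.
have m2 := nD _ _ lX lY.
have m3 := nrmB l2_hilbert lW1 lW2; have m4 := nD _ _ lXY lZ.
have m5 := ler_wpM2l CB0 nS.
rewrite !mulrDl.
have m6 := le_trans nZ m5.
move: (N (X + Y + Z)) (N (W1 - W2)) (N (X + Y)) (N X) (N Y) (N Z) (N W1) (N W2)
  m2 m3 m4 nX nY' m6 n1 n2 => x1 x2 x3 x4 x5 x6 x7 x8.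
move: (a * _) (s * _) (Num.sqrt CA * _) (CB * _) (L1 * _) (L2 * _) => y1 y2 y3 y4 y5 y6.
clear; lra.
Qed.

End Entries.
End RelativeBound.

(** * Jacobi operators and their adjoints *)

Section Link.
Context {R : realType} {p : nat}.
Local Notation E := (vecseq R p).
Local Notation "'N'" := (nrm rdot).
Local Notation D := (@finsupp R p).
Implicit Types (f g h : E) (sigma : R[i]).

Let HH := @l2_hilbert R p.
Let DH := @finsupp_l2 R p.
Let DZ := @finsuppZ R p.

Lemma l2cvgP (u : nat -> E) f : (forall k, l2 (u k)) -> l2 f ->
  l2cvg u f <-> (rdot (u k - f) (u k - f) @[k --> \oo] --> (0 : R)).
Proof.
move=> hu hf; rewrite /l2cvg.
have -> : (fun k => l2normsq (u k - f)) = (fun k => (rdot (u k - f) (u k - f))%:E).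
  by apply/funext => k; exact: (l2normsqE (hilB HH (hu k) hf)).
by split=> [/fine_cvgP[_]|h] //; apply: cvg_EFin => //; near=> k.
Unshelve. all: by end_near. Qed.

Lemma l2cvg_approx (u : nat -> E) f (e : R) : (forall k, l2 (u k)) -> l2 f ->
  l2cvg u f -> 0 < e -> \forall k \near \oo, N (u k - f) <= e.
Proof.
move=> hu hf /(l2cvgP hu hf)/cvgrPdist_le h e0.
have [k0 _ hk] := h _ (exprn_gt0 2 e0); exists k0 => // k /hk /=.
rewrite sub0r normrN => /(le_trans (ler_norm _)).
rewrite -(nrm_sqr HH (hilB HH (hu k) hf)).
by rewrite ler_sqr ?nnegrE ?nrm_ge0 ?(ltW e0).
Qed.

Lemma approx_l2cvg (u : nat -> E) f : (forall k, l2 (u k)) -> l2 f ->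
  (forall k, N (u k - f) <= k.+1%:R^-1) -> l2cvg u f.
Proof.
move=> hu hf h; apply/(l2cvgP hu hf).
apply: (squeeze_cvgr _ (cvg_cst 0) (@cvg_harmonic R)); near=> k => /=.
rewrite rdot_ge0/= -(nrm_sqr HH (hilB HH (hu k) hf)) expr2.
apply: (@le_trans _ _ (k.+1%:R^-1 * k.+1%:R^-1)).
  by apply: ler_pM; rewrite ?nrm_ge0 ?h.
by rewrite ler_piMr ?invr_ge0// invf_le1 ?ler1n ?ltr0n.
Unshelve. all: by end_near. Qed.

Lemma jacobi_opE A B : @jacobi_op R p A B = graph_closure l2 rdot D (jacobi_map A B).
Proof.
have lJ := (@jacobi_linear R p A B).1.
apply/seteqP; split=> -[f g].
- move=> [hf [hg [u [v [huv [uf vg]]]]]]; rewrite /= in hf hg.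
  split=> //; split=> // e e0.
  have hu k : finsupp (u k) by case: (huv k).
  have vE k : v k = jacobi_map A B (u k) by case: (huv k).
  have lu k : l2 (u k) by exact: DH (hu k).
  have lv k : l2 (v k) by rewrite vE; exact: lJ (hu k).
  have [k0 _ hk0] := l2cvg_approx lu hf uf e0; have [k1 _ hk1] := l2cvg_approx lv hg vg e0.
  exists (u (maxn k0 k1)); split; first exact: hu.
    by apply: hk0; rewrite /= leq_maxl.
  by rewrite -vE; apply: hk1; rewrite /= leq_maxr.
- move=> cS; have [hf [hg _]] := cS; rewrite /= in hf hg.
  have [u [Du uf ug]] := graph_closure_seq (@jacobi_linear R p A B) cS.
  split=> //; split=> //; exists u, (fun k => jacobi_map A B (u k)); split.
    by move=> k; split; [exact: Du|].
  split.
    exact: (approx_l2cvg (fun k => DH (Du k)) hf uf).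
  exact: (approx_l2cvg (fun k => lJ _ (Du k)) hg ug).
Qed.

Section OneOperator.
Variables A B : nat -> 'M[R[i]]_p.
Hypothesis A_herm : forall n, A n = (A n) ^t*.
Local Notation J := (jacobi_map A B).
Let symJ := @jacobi_symmetric R p A B A_herm.
Let linJ := @jacobi_linear R p A B.

(** Testing the adjoint relation on finitely supported sequences and on real
    parts suffices: the imaginary part follows from [adjoint_i], and the
    closure from [adjoint_graph_closure]. *)
Lemma op_adj_jacobiE : op_adj (jacobi_op A B) = adjoint l2 rdot D J.
Proof.
rewrite jacobi_opE; apply/seteqP; split=> -[g h].
- move=> [hg [hh a]]; rewrite /= in hg hh a.
  split=> //; split=> // x Dx /=.
  have cx : graph_closure l2 rdot D J (x, J x).
    split; first exact: DH Dx. split; first exact: linJ.1 _ Dx.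
    move=> e e0; exists x; split=> //=; by rewrite subrr (nrm0 HH) ltW.
  exact: etrans (esym (Re_l2dot (J x) g))
    (etrans (congr1 (@complex.Re R) (a x (J x) cx)) (Re_l2dot x h)).
- move=> aS; have [hg [hh _]] := aS; rewrite /= in hg hh.
  split=> //; split=> // f f' cS; rewrite !l2dotE.
  have aS' := adjoint_i HH DH DZ linJ aS.
  have [hf [hf' _]] := cS; rewrite /= in hf hf'.
  have su : imag_unit (- 'i : R[i]) by right.
  rewrite (adjoint_graph_closure HH DH linJ aS cS) (dot_unitN HH su hf' hg) (dot_unitN HH su hf hh).
  have e := adjoint_graph_closure HH DH linJ aS' cS.
  congr (_ +i* _).
  by rewrite !scaleNr (rdotC f') (rdotC f) !(dotNl HH) ?[rdot ('i *: _) _]rdotC ?e//;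
    exact: hilZ HH _ _ _.
Qed.

Lemma op_ker_jacobiE sigma : imag_unit sigma ->
  op_ker (op_shift (op_adj (jacobi_op A B)) sigma) = perp_ran l2 rdot D (translate J sigma).
Proof.
move=> su; rewrite op_adj_jacobiE; apply/seteqP; split=> h.
- by rewrite /op_ker /op_shift /= add0r => /(perp_ran_adjoint HH DH h symJ su).
- by move=> /(perp_ran_adjoint HH DH h symJ su); rewrite /op_ker /op_shift /= add0r.
Qed.

End OneOperator.

Lemma subspace_dim_eq (P Q : set E) :
  (forall k, has_lin_indep P k <-> has_lin_indep Q k) -> subspace_dim P = subspace_dim Q.
Proof.
move=> h; rewrite /subspace_dim; congr (ereal_sup _).
by apply/seteqP; split=> x [k /= hk <-]; exists k => //; apply/h.
Qed.

End Link.

(** * Resolvents *)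

Section Resolvent.
Context {R : realType} {p : nat}.
Local Notation E := (vecseq R p).
Local Notation "'N'" := (nrm rdot).
Local Notation D := (@finsupp R p).
Implicit Types (f g h u : E).

Let HH := @l2_hilbert R p.
Let DH := @finsupp_l2 R p.
Let D0 := @finsupp0 R p.
Let DD := @finsuppD R p.
Let DZ := @finsuppZ R p.

Variables A B : nat -> 'M[R[i]]_p.
Hypothesis A_herm : forall n, A n = (A n) ^t*.
Local Notation J := (jacobi_map A B).
Let symJ := @jacobi_symmetric R p A B A_herm.
Let sNu : imag_unit (- 'i : R[i]) := or_intror erefl.

Lemma selfadjoint_jacobiP : selfadjoint (jacobi_op A B) <->
  adjoint l2 rdot D J `<=` graph_closure l2 rdot D J.
Proof.
rewrite /selfadjoint op_adj_jacobiE// jacobi_opE; split=> [->//|h].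
by apply/seteqP; split=> // fg; exact: (graph_closure_adj HH DH symJ).
Qed.

Lemma l2normsq_le f (K : R) : l2 f -> 0 <= K -> N f <= K -> (l2normsq f <= (K ^+ 2)%:E)%E.
Proof.
move=> hf K0 fK; rewrite (l2normsqE hf) lee_fin -(nrm_sqr HH hf).
by rewrite ler_sqr ?nnegrE ?nrm_ge0.
Qed.

(** The image of f is u + i f, so this is [graph_closure_le] for sigma = -i. *)
Lemma resolvent_le u f : resolvent (jacobi_op A B) 'i (u, f) ->
  [/\ l2 u, l2 f, N f <= N u & N (u + 'i *: f) <= N u].
Proof.
rewrite /resolvent /op_inv /op_shift jacobi_opE /= => c.
have [hf [hg _]] := c; rewrite /= in hf hg.
have e : u = (u + 'i *: f) - 'i *: f by rewrite addrK.
have [n1 n2] := graph_closure_le HH DH DZ symJ sNu c.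
have e' : u + 'i *: f + - 'i *: f = u by rewrite scaleNr addrK.
rewrite e' in n1 n2; split=> //.
by rewrite e; exact: (hilB HH hg (hilZ HH 'i hf)).
Qed.

Lemma resolvent_bounded :
  (forall h, perp_ran l2 rdot D (translate J (- 'i)) h -> h = 0) ->
  bounded_on_l2 (resolvent (jacobi_op A B) 'i).
Proof.
move=> p0; split; [|split].
- by move=> u f /resolvent_le[].
- move=> u hu.
  have [f [g [c e]]] := graph_closure_surj HH DH D0 DD DZ symJ sNu p0 hu.
  have eg : g = u + 'i *: f by rewrite e scaleNr subrK.
  exists f; split.
    by rewrite /resolvent /op_inv /op_shift jacobi_opE /= -eg.
  move=> f'; rewrite /resolvent /op_inv /op_shift jacobi_opE /= => c'.
  apply: (graph_closure_inj HH DH DD DZ symJ sNu c c').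
  by rewrite -e scaleNr addrK.
- exists 1 => u f /resolvent_le[hu hf n1 _].
  rewrite (l2normsqE hu) mul1e -(nrm_sqr HH hu).
  exact: l2normsq_le hf (nrm_ge0 _) n1.
Qed.

End Resolvent.

(** * Transfer between two Jacobi operators *)

Section Comparison.
Context {R : realType} {p : nat}.
Local Notation E := (vecseq R p).
Local Notation "'N'" := (nrm rdot).
Local Notation D := (@finsupp R p).
Let HH := @l2_hilbert R p.
Let DH := @finsupp_l2 R p.
Let DD := @finsuppD R p.
Let DZ := @finsuppZ R p.
Variables A B hA hB : nat -> 'M[R[i]]_p.
Hypothesis hA_herm : forall n, hA n = (hA n) ^t*.
Local Notation J := (jacobi_map A B).
Local Notation hJ := (jacobi_map hA hB).
Variables al be : R.
Hypotheses (al0 : 0 <= al) (be0 : 0 <= be).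
Hypothesis dominated : forall f, finsupp f -> N (J f) <= al * N (hJ f) + be * N f.

Lemma jacobi_dom_sub : op_dom (jacobi_op hA hB) `<=` op_dom (jacobi_op A B).
Proof.
move=> f [g]; rewrite jacobi_opE => c.
have [g' c' _] := graph_closure_dom HH DH DD DZ (@jacobi_linear R p hA hB)
    (@jacobi_linear R p A B) al0 be0 dominated c.
by exists g'; rewrite jacobi_opE.
Qed.

(** With w the image of v k under the first operator, v k is the value of its
    resolvent at w - z (v k); these vectors stay bounded since the graph norm
    of the second operator dominates that of the first. *)
Lemma compact_resolvent_transfer z :
  compact_on_l2 (resolvent (jacobi_op A B) z) ->
  bounded_on_l2 (resolvent (jacobi_op hA hB) 'i) ->
  compact_on_l2 (resolvent (jacobi_op hA hB) 'i).
Proof.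
move=> [_ cptz] bi; split; first exact: bi.
move=> u v huv [M hM].
pose cz := `|complex.Re z| + `|complex.Im z|.
have cz0 : 0 <= cz by rewrite addr_ge0.
have /choice[w hw] : forall k, exists w, jacobi_op A B (v k, w) /\
    N w <= (al + be) * N (u k).
  move=> k; have [hu hv n1 n2] := resolvent_le hA_herm (huv k).
  have := huv k; rewrite /resolvent /op_inv /op_shift jacobi_opE /= => c.
  have [w c' n3] := graph_closure_dom HH DH DD DZ (@jacobi_linear R p hA hB)
    (@jacobi_linear R p A B) al0 be0 dominated c.
  exists w; split; first by rewrite jacobi_opE.
  apply: le_trans n3 _; rewrite mulrDl; apply: lerD; exact: ler_wpM2l.
apply: (cptz (fun k => w k - z *: v k)) => [k|].
  rewrite /resolvent /op_inv /op_shift /= subrK; exact: (hw k).1.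
exists (((al + be + cz) * Num.sqrt `|M|) ^+ 2) => k.
have [hu hv n1 n2] := resolvent_le hA_herm (huv k).
have [cw n3] := hw k.
have hwk : l2 (w k) by move: cw; rewrite jacobi_opE => -[_ []].
have hzv := hilZ HH z hv.
apply: l2normsq_le; first exact: (hilB HH hwk hzv).
  by rewrite mulr_ge0 ?sqrtr_ge0// !addr_ge0.
apply: le_trans (nrmB HH hwk hzv) _.
have n4 := nrmCZ HH z hv; have n5 := ler_wpM2l cz0 n1.
have n6 : N (u k) <= Num.sqrt `|M|.
  have := hM k; rewrite (l2normsqE hu) lee_fin => h.
  by apply: ler_wsqrtr; apply: le_trans h (ler_norm _).
have c0 : 0 <= al + be + cz by rewrite !addr_ge0.
apply: le_trans (ler_wpM2l c0 n6); rewrite mulrDl; apply: lerD => //.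
exact: le_trans n4 n5.
Qed.

End Comparison.

(** * Stability of domain, deficiency indices and discrete spectrum *)

Theorem theorem4p1 (R : realType) (p : nat) (p_gt0 : (0 < p)%N)
    (A B hA hB : nat -> 'M[R[i]]_p)
    (A_herm : forall n, A n = (A n) ^t*)
    (hA_herm : forall n, hA n = (hA n) ^t*)
    (B_unit : forall n, B n \in unitmx)
    (hB_unit : forall n, hB n \in unitmx)
    (N : nat)
    (cond_i :
      (ereal_sup [set (opnorm (1%:M - (hB n) ^t* *m invmx ((B n) ^t*)))%:E
                 | n in [set n | (N <= n)%N]] < 1)%E)
    (cond_ii :
      (ereal_sup [set (opnorm (hB n -
                    (hB n.-1) ^t* *m invmx ((B n.-1) ^t*) *m B n))%:E
                 | n in [set n | (N <= n)%N /\ (1 <= n)%N]] < +oo)%E)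
    (cond_iii :
      forall eps : R, 0 < eps ->
      exists N1 : nat, exists CA : R, (0 < N1)%N /\ 0 < CA /\
      forall f : vecseq R p, finsupp f ->
        (\sum_(N1 <= n <oo)
           ((vnorm ((hA n - (hB n.-1) ^t* *m invmx ((B n.-1) ^t*) *m A n)
                    *m f n)) ^+ 2)%:E
         <= eps%:E * l2normsq (jacobi_map A B f) + CA%:E * l2normsq f)%E) :
  (op_dom (jacobi_op A B) = op_dom (jacobi_op hA hB) /\
   deficiency_plus (jacobi_op A B) = deficiency_plus (jacobi_op hA hB) /\
   deficiency_minus (jacobi_op A B) = deficiency_minus (jacobi_op hA hB)) /\
  (selfadjoint (jacobi_op A B) -> discrete_spectrum (jacobi_op A B) ->
   selfadjoint (jacobi_op hA hB) /\ discrete_spectrum (jacobi_op hA hB)).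
Proof.
have [a0 [a00 a01 ha0]] := ereal_sup_lt (n0 := N) (leqnn N) (fun n => opnorm_ge0 _) cond_i.
rewrite lte_fin in a01.
have NP : (N <= N.+1)%N /\ (1 <= N.+1)%N by [].
have [CB [CB0 _ hCB]] := ereal_sup_lt NP (fun n => opnorm_ge0 _) cond_ii.
have a0P : 0 <= a0 < 1 by rewrite a00.
have [a [C [a1P C0 rel]]] := relative_bound B_unit a0P CB0 ha0
  (fun n Nn => hCB n.+1 (conj Nn isT)) cond_iii.
have symJ := @jacobi_symmetric R p A B A_herm.
have symhJ := @jacobi_symmetric R p hA hB hA_herm.
have HH := @l2_hilbert R p.
have DH := @finsupp_l2 R p.
have D0 := @finsupp0 R p.
have DD := @finsuppD R p.
have DZ := @finsuppZ R p.
have su : imag_unit ('i : R[i]) := or_introl erefl.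
have sNu : imag_unit (- 'i : R[i]) := or_intror erefl.
have transfer sigma k : imag_unit sigma ->
    has_lin_indep (perp_ran l2 rdot (@finsupp R p) (translate (jacobi_map A B) sigma)) k <->
    has_lin_indep (perp_ran l2 rdot (@finsupp R p) (translate (jacobi_map hA hB) sigma)) k.
  exact: (defect_transfer HH DH D0 DD DZ symJ symhJ a1P C0 rel).
have /andP[a1 a2] := a1P.
have b1 : 0 < 1 - a by rewrite subr_gt0.
have dom1 f : finsupp f -> nrm rdot (jacobi_map hA hB f) <=
    (1 + a) * nrm rdot (jacobi_map A B f) + C * nrm rdot f.
  move=> ff; have := rel f ff; have h1 := symJ.1.1 f ff; have h2 := symhJ.1.1 f ff.
  have := nrm_le_dist HH h2 h1.
  move: (nrm _ _) (nrm _ _) (nrm _ _) (nrm _ _) => x y z w; lra.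
have dom2 f : finsupp f -> nrm rdot (jacobi_map A B f) <=
    (1 - a)^-1 * nrm rdot (jacobi_map hA hB f) + C / (1 - a) * nrm rdot f.
  move=> ff; have := rel f ff; have h1 := symJ.1.1 f ff; have h2 := symhJ.1.1 f ff.
  have := nrm_le_dist HH h1 h2; rewrite (nrmBC HH h1 h2).
  move: (nrm _ _) (nrm _ _) (nrm _ _) (nrm _ _) => x y z w e1 e2.
  rewrite mulrAC mulrC -mulrDl ler_pdivlMr//; lra.
have i0 : 0 <= (1 - a)^-1 by rewrite invr_ge0 ltW.
have C'0 : 0 <= C / (1 - a) by rewrite mulr_ge0.
split; first split.
- by apply/seteqP; split; [apply: (jacobi_dom_sub _ C0 dom1); rewrite addr_ge0|
    exact: (jacobi_dom_sub i0 C'0 dom2)].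
- have defect sigma : imag_unit sigma ->
      subspace_dim (op_ker (op_shift (op_adj (jacobi_op A B)) sigma)) =
      subspace_dim (op_ker (op_shift (op_adj (jacobi_op hA hB)) sigma)).
    move=> s; rewrite (op_ker_jacobiE B A_herm s) (op_ker_jacobiE hB hA_herm s).
    by apply: subspace_dim_eq => k; exact: transfer.
  by split; [exact: defect su|exact: defect sNu].
move=> /(selfadjoint_jacobiP B A_herm) sa [z [_ cz]].
have p0 sigma : imag_unit sigma -> forall h,
    perp_ran l2 rdot (@finsupp R p) (translate (jacobi_map hA hB) sigma) h -> h = 0.
  move=> s; apply: (proj2 (trivial_no_lin_indep _)) => dim_hJ.
  have dim_J := proj2 (transfer sigma 1%N s) dim_hJ.
  apply: (proj1 (trivial_no_lin_indep _) _ dim_J) => h.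
  exact: (selfadjoint_perp HH DH DZ symJ s sa).
have bi := resolvent_bounded hA_herm (p0 _ sNu).
split; last first.
  exists 'i; split; first exact: bi.
  exact: (compact_resolvent_transfer hA_herm i0 C'0 dom2 cz bi).
apply/(selfadjoint_jacobiP hB hA_herm).
by apply: (perp_selfadjoint HH DH D0 DD DZ symhJ) => sigma h s; exact: p0.
Qed.
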